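(* Let $n$ and $i$ be integers with $1\leq i\leq\lfloor\frac{n}{2}\rfloor$, and let $G=C_n(1,\ldots,\hat{i},\ldots,\lfloor\frac{n}{2}\rfloor)$, i.e. $G=C_n(S)$ with $S=\{1,2,\ldots,\lfloor\frac{n}{2}\rfloor\}\setminus\{i\}$. The following are equivalent: (i) $G$ is $S_2$; (ii) $G$ is Cohen-Macaulay; (iii) $\gcd(i,n)=1$.
   Context: For an integer $n\geq 1$ and $S\subseteq\{1,2,\ldots,\lfloor n/2\rfloor\}$, the circulant graph $C_n(S)$ has vertex set $\{0,1,\ldots,n-1\}$ and edge set $\{\{i,j\} : |i-j|\in S \text{ or } n-|i-j|\in S\}$. The independence complex $\mathrm{Ind}(G)$ of a finite simple graph $G$ is the simplicial complex whose faces are the independent sets of $G$ (including the empty set). A simplicial complex is Cohen-Macaulay if its Stanley-Reisner ring over every field is Cohen-Macaulay; $G$ is Cohen-Macaulay if $\mathrm{Ind}(G)$ is. A simplicial complex $\Delta$ satisfies Serre's condition $S_2$ (over a field $k$) if its Stanley-Reisner ring $R=k[\Delta]$ satisfies $\mathrm{depth}(R_p)\geq\min\{2,\dim R_p\}$ for all primes $p$. It is known that this holds if and only if $\mathrm{link}_\Delta(F)$ is connected for every face $F\in\Delta$ (including $F=\emptyset$) with $\dim\mathrm{link}_\Delta(F)\geq 1$, where $\mathrm{link}_\Delta(F)=\{H\in\Delta : H\cap F=\emptyset,\ H\cup F\in\Delta\}$; in particular it does not depend on $k$. A graph $G$ is called $S_2$ if $\mathrm{Ind}(G)$ satisfies $S_2$.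 *)

(* Defs.v *)
From HB Require Import structures.
From mathcomp Require Import all_boot all_algebra.
From mathcomp Require Import boolp mpoly ring.

Set Implicit Arguments.
Unset Strict Implicit.
Unset Printing Implicit Defensive.

Import GRing.Theory.
Local Open Scope ring_scope.
Local Open Scope quotient_scope.

(* The localization of R at the prime ideal p: the quotient of the set of
   fractions (a, s), s \notin p, by
     (a, s) ~ (b, t)  iff  u (a t) = u (b s) for some u \notin p.
   The library's ideals are boolean predicates; classically ([boolp]) these
   are all the subsets that are ideals. *)
Module Localization.
Section Localization.
Variables (R : comNzRingType) (p : prime_idealr R).

Definition fraction : Type := (R * {s : R | s \notin p})%type.
HB.instance Definition _ := Choice.on fraction.

Implicit Types x y z : fraction.

Definition num x : R := x.1.
Definition den x : R := val x.2.
Definition frac (a s : R) (sP : s \notin p) : fraction := (a, exist _ s sP).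

Lemma denP x : den x \notin p. Proof. exact: valP x.2. Qed.

Lemma notin_mul (s t : R) : s \notin p -> t \notin p -> s * t \notin p.
Proof. by rewrite prime_idealrM negb_or => -> ->. Qed.

Lemma notin_one : 1 \notin p. Proof. by rewrite idealr1. Qed.

Definition equiv x y : bool :=
  `[< exists2 u : R, u \notin p & u * (num x * den y) = u * (num y * den x) >].

Lemma equiv_is_equiv : equiv_class_of equiv.
Proof.
split=> [x|x y|y x z].
- by apply/asboolP; exists 1; rewrite ?notin_one.
- by apply/asboolP/asboolP => -[u uP e]; exists u.
move=> /asboolP[u uP e] /asboolP[v vP f]; apply/asboolP.
exists (u * v * den y).
  by apply: notin_mul (denP y); apply: notin_mul.
transitivity (v * den z * (u * (num x * den y))); first by ring.
rewrite e; transitivity (u * den x * (v * (num y * den z))); first by ring.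
by rewrite f; ring.
Qed.

Canonical equiv_equiv := EquivRelPack equiv_is_equiv.
Canonical equiv_encModRel := defaultEncModRel equiv.

Definition type := {eq_quot equiv}.

#[export]
HB.instance Definition _ : EqQuotient fraction equiv type := EqQuotient.on type.
#[export]
HB.instance Definition _ := Choice.on type.

Definition zerof : fraction := frac 0 notin_one.
Definition onef : fraction := frac 1 notin_one.
Definition oppf x : fraction := frac (- num x) (denP x).
Definition addf x y : fraction :=
  frac (num x * den y + num y * den x) (notin_mul (denP x) (denP y)).
Definition mulf x y : fraction :=
  frac (num x * num y) (notin_mul (denP x) (denP y)).

Lemma equivP x y :
  reflect (exists2 u, u \notin p & u * (num x * den y) = u * (num y * den x))
          (x == y %[mod type]).
Proof. by rewrite piE; apply: asboolP. Qed.

Lemma pi_eq x y : num x * den y = num y * den x -> x = y %[mod type].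
Proof. by move=> e; apply/eqP/equivP; exists 1; rewrite ?notin_one ?e. Qed.

Lemma repr_piP x : exists2 u, u \notin p &
  u * (num (repr (\pi_type x)) * den x) = u * (num x * den (repr (\pi_type x))).
Proof. by apply/equivP; rewrite reprK. Qed.

Definition zero : type := lift_cst type zerof.
Definition one : type := lift_cst type onef.
Definition opp := lift_op1 type oppf.
Definition add := lift_op2 type addf.
Definition mul := lift_op2 type mulf.

Canonical pi_zero_morph := PiConst zero.
Canonical pi_one_morph := PiConst one.

Lemma pi_opp : {morph \pi_type : x / oppf x >-> opp x}.
Proof.
move=> x; unlock opp; apply/eqP/equivP.
have [u uP] := repr_piP x; move: (repr _) => x' e.
exists u => //; rewrite /oppf /num /den /= -!/(num _) -!/(den _).
by rewrite !mulNr !mulrN e.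
Qed.
Canonical pi_opp_morph := PiMorph1 pi_opp.

Lemma pi_add : {morph \pi_type : x y / addf x y >-> add x y}.
Proof.
move=> x y; unlock add; apply/eqP/equivP.
have [u uP] := repr_piP x; move: (repr _) => x' e.
have [v vP] := repr_piP y; move: (repr _) => y' f.
exists (u * v); first exact: notin_mul.
rewrite /addf /num /den /= -!/(num _) -!/(den _).
transitivity (v * (den y * den y') * (u * (num x * den x'))
            + u * (den x * den x') * (v * (num y * den y'))); first by ring.
by rewrite -e -f; ring.
Qed.
Canonical pi_add_morph := PiMorph2 pi_add.

Lemma pi_mul : {morph \pi_type : x y / mulf x y >-> mul x y}.
Proof.
move=> x y; unlock mul; apply/eqP/equivP.
have [u uP] := repr_piP x; move: (repr _) => x' e.
have [v vP] := repr_piP y; move: (repr _) => y' f.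
exists (u * v); first exact: notin_mul.
rewrite /mulf /num /den /= -!/(num _) -!/(den _).
transitivity (u * (num x * den x') * (v * (num y * den y'))); first by ring.
by rewrite -e -f; ring.
Qed.
Canonical pi_mul_morph := PiMorph2 pi_mul.

Lemma addA : associative add.
Proof.
move=> x y z; rewrite -[x]reprK -[y]reprK -[z]reprK !piE.
by apply: pi_eq; rewrite /addf /num /den /=; ring.
Qed.

Lemma addC : commutative add.
Proof.
move=> x y; rewrite -[x]reprK -[y]reprK !piE.
by apply: pi_eq; rewrite /addf /num /den /=; ring.
Qed.

Lemma add0 : left_id zero add.
Proof.
move=> x; rewrite -[x]reprK !piE.
by apply: pi_eq; rewrite /addf /num /den /=; ring.
Qed.

Lemma addN : left_inverse zero opp add.
Proof.
move=> x; rewrite -[x]reprK !piE.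
by apply: pi_eq; rewrite /addf /oppf /num /den /=; ring.
Qed.

Lemma mulA : associative mul.
Proof.
move=> x y z; rewrite -[x]reprK -[y]reprK -[z]reprK !piE.
by apply: pi_eq; rewrite /mulf /num /den /=; ring.
Qed.

Lemma mulC : commutative mul.
Proof.
move=> x y; rewrite -[x]reprK -[y]reprK !piE.
by apply: pi_eq; rewrite /mulf /num /den /=; ring.
Qed.

Lemma mul1 : left_id one mul.
Proof.
move=> x; rewrite -[x]reprK !piE.
by apply: pi_eq; rewrite /mulf /num /den /=; ring.
Qed.

Lemma mulDl : left_distributive mul add.
Proof.
move=> x y z; rewrite -[x]reprK -[y]reprK -[z]reprK !piE.
by apply: pi_eq; rewrite /mulf /addf /num /den /=; ring.
Qed.

Lemma one_neq0 : one != zero.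
Proof.
rewrite piE; apply/negP => /asboolP[u uP].
rewrite /num /den /= !mulr1 mulr0 => u0.
by move: uP; rewrite u0 idealr0.
Qed.

#[export]
HB.instance Definition _ :=
  GRing.isZmodule.Build type addA addC add0 addN.
#[export]
HB.instance Definition _ :=
  GRing.Zmodule_isComNzRing.Build type mulA mulC mul1 mulDl one_neq0.

End Localization.

Module Exports. HB.reexport. End Exports.
End Localization.

Notation localization := Localization.type.
Export Localization.Exports.

Section CommutativeAlgebra.

Definition prime_ltn (A : comNzRingType) (P Q : prime_idealr A) : Prop :=
  {subset P <= Q} /\ exists2 x : A, x \in Q & x \notin P.

(* A chain P_0 < ... < P_d of prime ideals has length d; the values of P
   beyond d are irrelevant. *)
Definition has_prime_chain (A : comNzRingType) (d : nat) : Prop :=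
  exists P : nat -> prime_idealr A,
    forall i, (i < d)%N -> prime_ltn (P i) (P i.+1).

Definition has_krull_dim (A : comNzRingType) (d : nat) : Prop :=
  has_prime_chain A d /\ forall d', has_prime_chain A d' -> (d' <= d)%N.

Definition in_ideal (A : comNzRingType) (s : seq A) (y : A) : Prop :=
  exists c : 'I_(size s) -> A, y = \sum_(j < size s) c j * s`_j.

(* s_j is a nonzerodivisor on A / (s_0, ..., s_(j-1)), and A / (s) <> 0. *)
Definition regular_sequence (A : comNzRingType) (s : seq A) : Prop :=
  (forall j, (j < size s)%N -> forall y : A,
     in_ideal (take j s) (s`_j * y) -> in_ideal (take j s) y)
  /\ ~ in_ideal s 1.

Definition nonunit (A : comNzRingType) (x : A) : Prop :=
  ~ exists y : A, x * y = 1.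

Definition has_local_regular_sequence (A : comNzRingType) (r : nat) : Prop :=
  exists s : seq A, [/\ size s = r, {in s, forall x, nonunit x}
                      & regular_sequence s].

(* The depth of a local ring A: its maximal ideal is the set of nonunits. *)
Definition has_depth (A : comNzRingType) (r : nat) : Prop :=
  has_local_regular_sequence A r /\
  forall r', has_local_regular_sequence A r' -> (r' <= r)%N.

(* The two notions below are meant for Noetherian rings, whose localizations
   at primes have finite dimension and depth. *)
Definition serre_condition (r : nat) (R : comNzRingType) : Prop :=
  forall p : prime_idealr R, exists d e,
    [/\ has_krull_dim (localization p) d, has_depth (localization p) e
      & (minn r d <= e)%N].

Definition cohen_macaulay_ring (R : comNzRingType) : Prop :=
  forall p : prime_idealr R, exists2 d,
    has_krull_dim (localization p) d & has_depth (localization p) d.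

End CommutativeAlgebra.

Record simplicial_complex (T : finType) := SimplicialComplex {
  faces :> {set {set T}};
  face0 : set0 \in faces;
  face_sub : forall F H : {set T}, F \in faces -> H \subset F -> H \in faces
}.

Section StanleyReisner.
Variables (k : fieldType) (n : nat) (Delta : simplicial_complex 'I_n).

(* The ideal generated by the squarefree monomials of the nonfaces. *)
Definition sr_ideal : {pred {mpoly k[n]}} := fun f =>
  `[< exists c : {set 'I_n} -> {mpoly k[n]},
        f = \sum_(F : {set 'I_n} | F \notin Delta) c F * \prod_(j in F) 'X_j >].

Lemma sr_ideal_closed : idealr_closed sr_ideal.
Proof.
split.
- apply/asboolP; exists (fun=> 0).
  by rewrite big1 // => F _; rewrite mul0r.
- apply/asboolP => -[c e].
  have /eqP := congr1 (fun f => f.@[fun=> 0]) e; apply/negP.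
  rewrite meval1 raddf_sum big1 ?oner_neq0 //= => F FN.
  have [F0|[j jF]] := set_0Vmem F; first by rewrite F0 face0 in FN.
  by rewrite mevalM (bigD1 j) //= mevalM mevalXU mul0r mulr0.
- move=> a f g /asboolP[c ->] /asboolP[d ->]; apply/asboolP.
  exists (fun F => a * c F + d F).
  rewrite mulr_sumr -big_split; apply: eq_bigr => F _ /=.
  by rewrite mulrDl mulrA.
Qed.

HB.instance Definition _ := isIdealr.Build {mpoly k[n]} sr_ideal sr_ideal_closed.

Definition stanley_reisner_ring : comNzRingType := {ideal_quot sr_ideal}.

End StanleyReisner.

Definition S2_complex (k : fieldType) n (Delta : simplicial_complex 'I_n) :=
  serre_condition 2 (stanley_reisner_ring k Delta).

Definition cohen_macaulay_complex n (Delta : simplicial_complex 'I_n) :=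
  forall k : fieldType, cohen_macaulay_ring (stanley_reisner_ring k Delta).

Record simple_graph (T : finType) := SimpleGraph {
  edge :> rel T;
  edge_sym : ssrbool.symmetric edge;
  edge_irr : irreflexive edge
}.

Section Independence.
Variables (T : finType) (G : simple_graph T).

Definition independent (F : {set T}) : bool :=
  [forall a in F, forall b in F, ~~ G a b].

Lemma independent0 : set0 \in [set F | independent F].
Proof. by rewrite inE; apply/forall_inP => a; rewrite inE. Qed.

Lemma independent_sub (F H : {set T}) :
  F \in [set F | independent F] -> H \subset F -> H \in [set F | independent F].
Proof.
rewrite !inE => /forall_inP Find /subsetP sHF.
apply/forall_inP => a /sHF aF; apply/forall_inP => b /sHF.
exact: (forall_inP (Find a aF)).
Qed.

Definition independence_complex : simplicial_complex T :=
  SimplicialComplex independent0 independent_sub.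

End Independence.

Definition S2_graph (k : fieldType) n (G : simple_graph 'I_n) :=
  S2_complex k (independence_complex G).

Definition cohen_macaulay_graph n (G : simple_graph 'I_n) :=
  cohen_macaulay_complex (independence_complex G).

Section Circulant.
Variables (n : nat) (S : {pred nat}).

(* [`|a - b|%N] is the distance in [nat], not the truncated difference. *)
Definition circulant_rel : rel 'I_n := fun a b =>
  (`|a - b| \in S)%N || (n - `|a - b| \in S)%N.

Hypothesis S_sub : forall j, j \in S -> (1 <= j <= n./2)%N.

Lemma circulant_sym : ssrbool.symmetric circulant_rel.
Proof. by move=> a b; rewrite /circulant_rel distnC. Qed.

Lemma circulant_irr : irreflexive circulant_rel.
Proof.
move=> a; rewrite /circulant_rel distnn subn0; apply/negP => /orP[] /S_sub //.
case/andP => n_gt0; rewrite leqNgt => /negP; apply.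
by rewrite -divn2 ltn_Pdiv.
Qed.

Definition circulant : simple_graph 'I_n :=
  SimpleGraph circulant_sym circulant_irr.

End Circulant.

Definition all_but (n i : nat) : {pred nat} :=
  [pred j | (1 <= j <= n./2)%N && (j != i)].

Lemma all_but_sub n i j : j \in all_but n i -> (1 <= j <= n./2)%N.
Proof. by case/andP. Qed.

(* C_n(1, ..., i^, ..., n./2) *)
Definition circulant_all_but (n i : nat) : simple_graph 'I_n :=
  circulant (@all_but_sub n i).

(* Main.v *)
(* A face of Ind(G) is a set of vertices pairwise at cyclic distance i, so Ind(G)
   is a disjoint union of gcd(i, n) cycles of length n / gcd(i, n), where a cycle
   of length 2 is an edge and one of length 3 is a full triangle.

   If gcd(i, n) > 1 the complex is disconnected, and the localization of its
   Stanley-Reisner ring R at the irrelevant maximal ideal has dimension at least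
   2 but depth at most 1.

   If gcd(i, n) = 1 it suffices to find, at each prime P of R, a sequence s in P
   that is regular in R_P and a sequence t that is algebraically independent
   modulo P, with size s + size t = m the largest size of a face. Indeed, adding
   to t an element of each step of a chain of primes below P keeps it
   algebraically independent, and R has only O(M^m) independent elements in
   degree at most M, so chains have length at most size s; conversely, regular
   sequences produce chains of primes. For polynomial rings (n = 3) the pair
   (s, t) is built one variable at a time. For a cycle (or an edge), let theta1
   be the sum of the variables and theta2 the sum of x_a x_b over the edges ab.
   They are algebraically independent on every edge, so a nonzero h in
   k[theta1, theta2] is a nonzerodivisor; and if P contains nonzero f(theta1) and
   g(theta2), these form a regular sequence, because division by f(theta1) can be
   carried out on each edge and the quotients glue along the cycle. *)

Require Import Defs.
From HB Require Import structures.
From mathcomp Require Import all_boot all_algebra.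
From mathcomp Require Import boolp mpoly ring zify.
From mathcomp Require classical_sets.

Set Implicit Arguments.
Unset Strict Implicit.
Unset Printing Implicit Defensive.

Import GRing.Theory.
Local Open Scope ring_scope.
Local Open Scope quotient_scope.

(** * Primes and regular sequences *)

Section PrimeIdeals.
Variable R : comNzRingType.
Implicit Types (I J M : R -> Prop) (P Q : prime_idealr R).

Definition ideal_prop I := I 0 /\ forall a x y, I x -> I y -> I (a * x + y).

Lemma ideal_propM I a x : ideal_prop I -> I x -> I (a * x).
Proof. by move=> [I0 IL] Ix; rewrite -[a * x]addr0; apply: IL. Qed.

Lemma ideal_propD I x y : ideal_prop I -> I x -> I y -> I (x + y).
Proof. by move=> [I0 IL] Ix Iy; rewrite -[x]mul1r; apply: IL. Qed.

Lemma ideal_propB I x y : ideal_prop I -> I x -> I y -> I (x - y).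
Proof.
by move=> [I0 IL] Ix Iy; rewrite addrC -mulN1r; apply: IL.
Qed.

Lemma ideal_prop_sum I (T : Type) (r : seq T) (p : pred T) (F : T -> R) :
  ideal_prop I -> (forall i, p i -> I (F i)) -> I (\sum_(i <- r | p i) F i).
Proof.
by move=> Iid; apply: big_ind => [|x y]; [case: Iid|exact: ideal_propD].
Qed.

(** Classical decidability turns a [Prop]-valued ideal into the boolean predicate that
    [prime_idealr] packs. *)
Lemma prime_idealr_of (Q : R -> Prop) :
  ideal_prop Q -> ~ Q 1 -> (forall x y, Q (x * y) -> Q x \/ Q y) ->
  exists P : prime_idealr R, forall x, (x \in P) = `[< Q x >].
Proof.
move=> [Q0 QL] Q1 QM; pose S := fun x : R => `[< Q x >].
have Sid : idealr_closed S.
  split; first exact/asboolP.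
  - by apply/asboolP.
  - by move=> a x y /asboolP Qx /asboolP Qy; apply/asboolP/QL.
have Spr : prime_idealr_closed S.
  move=> x y /asboolP /QM[] Q'; apply/orP; [left|right]; exact/asboolP.
pose Sm := isIdealr.Build R S Sid.
pose Sp := isPrimeIdealrClosed.Build R S Spr.
pose P : prime_idealr R := HB.pack S Sm Sp.
by exists P.
Qed.

(* An ideal maximal among those disjoint from a multiplicative set is prime. *)
Lemma prime_disjoint I M :
  ideal_prop I -> M 1 -> (forall x y, M x -> M y -> M (x * y)) ->
  (forall x, I x -> ~ M x) ->
  exists P, (forall x, I x -> x \in P) /\ (forall x, M x -> x \notin P).
Proof.
move=> Iid M1 MM IM.
pose good J := [/\ ideal_prop J, forall x, I x -> J x & forall x, J x -> ~ M x].
pose T := {J | good J}; have t0 : T by exists I; split.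
pose le (A B : T) := `[< forall x, sval A x -> sval B x >].
have [|||[J gJ] Jmax] := @classical_sets.ZL_preorder T t0 le.
- by move=> A; apply/asboolP.
- move=> A B C /asboolP BA /asboolP AC; apply/asboolP => x Bx.
  exact/AC/BA.
(* A nonempty chain is bounded by its union, the empty one by I itself. *)
- move=> F Ftot; have [[A0 FA0]|F0] := EM (exists A, F A); last first.
    by exists t0 => A FA; case: F0; exists A.
  pose U x := exists2 A : T, F A & sval A x.
  have gU : good U.
    split; first split.
    + by exists A0 => //; case: (svalP A0) => -[].
    + move=> a x y [A FA Ax] [B FB By].
      have [/asboolP AB|/asboolP BA] := Ftot _ _ FA FB.
        by exists B => //; case: (svalP B) => -[_ L] _ _; apply: L => //; apply: AB.
      by exists A => //; case: (svalP A) => -[_ L] _ _; apply: L => //; apply: BA.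
    + by move=> x Ix; exists A0 => //; case: (svalP A0) => _ + _; apply.
    + by move=> x [A FA Ax]; case: (svalP A) => _ _; apply.
  exists (exist _ U gU) => A FA; apply/asboolP => x Ax; by exists A.
have [Jid IJ JM] := gJ.
(* By maximality, the ideal generated by J and u meets M. *)
have step u : ~ J u -> exists2 j, J j & exists a, M (a * u + j).
  move=> nJu; apply: contrapT => H.
  pose K x := exists a, exists2 j, J j & x = a * u + j.
  have gK : good K.
    split; first split.
    + by exists 0, 0; rewrite ?mul0r ?addr0 //; case: Jid.
    + move=> a _ _ [b [j Jj ->]] [c [l Jl ->]].
      by exists (a * b + c), (a * j + l); [case: Jid => _; apply|ring].
    + by move=> x /IJ Jx; exists 0, x; rewrite // mul0r add0r.
    + by move=> _ [a [j Jj ->]] Max; apply: H; exists j => //; exists a.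
  apply: nJu; have /asboolP : le (exist _ K gK) (exist _ J gJ).
    apply: Jmax; apply/asboolP => x /= Jx.
    by exists 0, x; rewrite // mul0r add0r.
  by apply=> /=; exists 1, 0; [case: Jid|rewrite mul1r addr0].
have [||P PJ] := prime_idealr_of Jid.
- by move=> J1; apply: (JM 1).
- move=> x y Jxy; apply: contrapT => /not_orP[/step[j Jj [a Ma]] /step[l Jl [b Mb]]].
  apply: (JM _ _ (MM _ _ Ma Mb)).
  have -> : (a * x + j) * (b * y + l)
     = (a * b) * (x * y) + ((a * x) * l + ((b * y) * j + l * j)) by ring.
  by do 3![apply: (proj2 Jid) => //]; apply: ideal_propM.
by exists P; split=> x; rewrite PJ => H; [apply/asboolP/IJ|apply/asboolPn => /JM].
Qed.

Lemma in_ideal_prop (s : seq R) : ideal_prop (in_ideal s).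
Proof.
split=> [|a _ _ [c ->] [d ->]].
  by exists (fun=> 0); rewrite big1 // => j _; rewrite mul0r.
exists (fun j => a * c j + d j).
by rewrite mulr_sumr -big_split; apply: eq_bigr => j _ /=; rewrite mulrDl mulrA.
Qed.

Lemma mem_in_ideal (s : seq R) x : x \in s -> in_ideal s x.
Proof.
move=> xs; have xi : (index x s < size s)%N by rewrite index_mem.
exists (fun j => (j == Ordinal xi)%:R).
rewrite (bigD1 (Ordinal xi)) //= eqxx mul1r nth_index // big1 ?addr0 //.
by move=> j /negPf ->; rewrite mul0r.
Qed.

Lemma in_ideal_min (s : seq R) I :
  ideal_prop I -> (forall x, x \in s -> I x) -> forall x, in_ideal s x -> I x.
Proof.
move=> Iid sI _ [c ->]; apply: ideal_prop_sum => // j _.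
by apply: ideal_propM => //; apply: sI; rewrite mem_nth.
Qed.

Lemma in_ideal_nil x : in_ideal [::] x -> x = 0 :> R.
Proof. by move=> [c ->]; rewrite big_ord0. Qed.

Lemma in_ideal1 (a x : R) : in_ideal [:: a] x <-> exists b, x = b * a.
Proof.
split=> [[c ->]|[b ->]]; first by exists (c ord0); rewrite big_ord_recl big_ord0 addr0.
by apply: ideal_propM (in_ideal_prop _) _; apply: mem_in_ideal; rewrite inE.
Qed.

Lemma prime_prop P : ideal_prop (fun x => x \in P).
Proof. by split=> [|a x y xP yP]; rewrite ?idealr0 // rpredD // idealMr. Qed.

(** Since s is a nonzerodivisor modulo I, the ideal I misses all products s^k t with t outside P. A
    prime over I that avoids these products lies inside P and does not contain s. *)
Lemma prime_below I P s :
  ideal_prop I -> (forall x, I x -> x \in P) ->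
  (forall x, I (s * x) -> I x) ->
  exists Q, [/\ {subset Q <= P}, forall x, I x -> x \in Q & s \notin Q].
Proof.
move=> Iid IP sI.
pose M x := exists k t, t \notin P /\ x = s ^+ k * t.
have sIX k x : I (s ^+ k * x) -> I x.
  by elim: k => [|k IH]; rewrite ?expr0 ?mul1r // exprS -mulrA => /sI.
have [||x Ix [k [t [tP xE]]]|Q [IQ QM]] := prime_disjoint Iid (M := M).
- by exists 0%N, 1; rewrite idealr1 expr0 mulr1.
- move=> _ _ [k [t [tP ->]]] [l [u [uP ->]]]; exists (k + l)%N, (t * u).
  by rewrite prime_idealrM negb_or tP uP exprD mulrACA.
- by apply/negP: tP; rewrite negbK; apply: IP; apply: (sIX k); rewrite -xE.
exists Q; split=> // [x xQ|].
  by apply: contraLR xQ => xP; apply: QM; exists 0%N, x; rewrite expr0 mul1r.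
by apply: QM; exists 1%N, 1; rewrite idealr1 expr1 mulr1.
Qed.

(** The chain is built downwards from P: [prime_below] yields a prime inside the current one that
    keeps the earlier entries of s and loses the last one, which makes the step strict. *)
Lemma regular_chain (s : seq R) j P :
  (forall j, (j < size s)%N -> forall y,
     in_ideal (take j s) (s`_j * y) -> in_ideal (take j s) y) ->
  (j <= size s)%N -> (forall x, in_ideal (take j s) x -> x \in P) ->
  exists C : nat -> prime_idealr R, C j = P /\
    forall i, (i < j)%N -> prime_ltn (C i) (C i.+1).
Proof.
move=> sreg; elim: j P => [|j IH] P js sP; first by exists (fun=> P).
have sub x : x \in take j s -> x \in take j.+1 s.
  by rewrite (take_nth 0 js) mem_rcons inE => ->; rewrite orbT.
have [x|Q [QP sQ sjQ]] := prime_below (P := P) (in_ideal_prop _) _ (sreg j js).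
  move=> H; apply: sP; apply: in_ideal_min H => [|y /sub]; first exact: in_ideal_prop.
  exact: mem_in_ideal.
have [C [Cj CS]] := IH Q (ltnW js) sQ.
exists (fun i => if (i <= j)%N then C i else P); split; first by rewrite ltnn.
move=> i; rewrite ltnS => ij; rewrite ij; case: ltngtP ij => // [ij|->] _.
  exact: CS.
rewrite Cj; split=> //; exists s`_j => //; apply: sP; apply: mem_in_ideal.
by rewrite (take_nth 0 js) mem_rcons inE eqxx.
Qed.

Lemma regular_sequence_chain (s : seq R) :
  regular_sequence s -> has_prime_chain R (size s).
Proof.
move=> [sreg s1].
(* Avoiding the multiplicative set {1} means being proper, so this is a prime containing s. *)
have [||x y|P [sP _]] := prime_disjoint (in_ideal_prop s) (M := fun x => x = 1).
- by [].
- by move=> x y -> ->; rewrite mulr1.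
- by move=> y1; rewrite y1 in y.
have [|C [_ CP]] := regular_chain (j := size s) (P := P) sreg (leqnn _).
  by rewrite take_size.
by exists C.
Qed.

End PrimeIdeals.

(** * Localization at a prime *)

Section LocalizationMap.
Variables (R : comNzRingType) (P : prime_idealr R).
Local Notation L := (localization P).
Implicit Types (a u : R) (x : L).

Definition loc (a : R) : L := \pi_L (Localization.frac a (Localization.notin_one P)).

Lemma loc_additive : zmod_morphism loc.
Proof.
move=> a b; change (loc (a - b) = Localization.add (loc a) (Localization.opp (loc b))).
rewrite /loc -Localization.pi_opp -Localization.pi_add.
by apply: Localization.pi_eq; rewrite /Localization.addf /Localization.mulf
   /Localization.oppf /Localization.num /Localization.den /=; ring.
Qed.

Lemma loc_multiplicative : monoid_morphism loc.
Proof.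
split=> [|a b].
  by change (loc 1 = Localization.one P); rewrite /loc; unlock Localization.one.
change (loc (a * b) = Localization.mul (loc a) (loc b)).
rewrite /loc -Localization.pi_mul.
by apply: Localization.pi_eq; rewrite /Localization.addf /Localization.mulf
   /Localization.oppf /Localization.num /Localization.den /=; ring.
Qed.

HB.instance Definition _ := GRing.isZmodMorphism.Build R L loc loc_additive.
HB.instance Definition _ := GRing.isMonoidMorphism.Build R L loc loc_multiplicative.

Lemma loc_eq0 a : loc a = 0 <-> exists2 u, u \notin P & u * a = 0.
Proof.
rewrite -(rmorph0 loc); split.
  move=> /eqP/Localization.equivP[u uP]; rewrite /Localization.num /Localization.den /=.
  by rewrite mul0r mulr0 mulr1 => H; exists u.
move=> [u uP ua]; apply/eqP/Localization.equivP; exists u => //.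
by rewrite /Localization.num /Localization.den /= mul0r mulr0 mulr1.
Qed.

Lemma loc_unit (s : R) : s \notin P -> exists x, loc s * x = 1.
Proof.
move=> sP; exists (\pi_L (Localization.frac 1 sP)).
rewrite -(rmorph1 loc); change (Localization.mul (loc s) (\pi_L (Localization.frac 1 sP)) = loc 1).
rewrite /loc -Localization.pi_mul.
by apply: Localization.pi_eq; rewrite /Localization.addf /Localization.mulf
   /Localization.oppf /Localization.num /Localization.den /=; ring.
Qed.

Lemma locP x : exists a s, s \notin P /\ loc s * x = loc a.
Proof.
rewrite -[x]reprK; case: (repr x) => a [s sP]; exists a, s; split=> //.
change (Localization.mul (loc s) (\pi_L (Localization.frac a sP)) = loc a).
rewrite /loc -Localization.pi_mul.
by apply: Localization.pi_eq; rewrite /Localization.addf /Localization.mulf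
   /Localization.oppf /Localization.num /Localization.den /=; ring.
Qed.

Lemma loc_mulI (s : R) x (y : L) : s \notin P -> loc s * x = loc s * y -> x = y.
Proof.
move=> /loc_unit[z sz] e; rewrite -[x]mul1r -[y]mul1r -sz.
by rewrite mulrAC e mulrAC.
Qed.

Lemma loc_nonunit a : a \in P -> nonunit (loc a).
Proof.
move=> aP [x]; have [b [s [sP e]]] := locP x => ax.
have /loc_eq0[u uP] : loc (a * b - s) = 0.
  by rewrite rmorphB rmorphM /= -e mulrCA ax mulr1 subrr.
rewrite mulrBr => /eqP; rewrite subr_eq0 => /eqP e2.
have : u * s \notin P by apply: Localization.notin_mul.
by rewrite -e2 mulrCA mulrC idealMr // mulrC idealMr.
Qed.

Lemma loc_nonunitP x : nonunit x -> exists a s, [/\ a \in P, s \notin P & loc s * x = loc a].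
Proof.
move=> xN; have [a [s [sP e]]] := locP x; exists a, s; split=> //.
apply/negPn/negP => aP; apply: xN; have [y ay] := loc_unit aP.
by exists (loc s * y); rewrite mulrCA mulrA e.
Qed.

Lemma loc_in_ideal (s : seq R) a :
  in_ideal (map loc s) (loc a) <-> exists2 u, u \notin P & in_ideal s (u * a).
Proof.
split=> [H|[u uP ua]].
  suff [u [uP [b [/loc_eq0[v vP e] sb]]]] : exists u, u \notin P /\
      exists b, loc (u * a - b) = 0 /\ in_ideal s b.
    exists (v * u); first exact: Localization.notin_mul.
    move/eqP: e; rewrite mulrBr subr_eq0 mulrA => /eqP ->.
    exact: ideal_propM (in_ideal_prop s) _.
  (* The elements that some denominator outside P carries into the image of (s) form an ideal
     containing the generators. *)
  pose I x := exists u, u \notin P /\ exists b, loc u * x = loc b /\ in_ideal s b.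
  have Iid : ideal_prop I.
    split.
      exists 1; rewrite idealr1; split=> //; exists 0; rewrite mulr0 rmorph0.
      by split=> //; case: (in_ideal_prop s).
    move=> a' x y [u [uP [b [eb sb]]]] [v [vP [c [ec sc]]]].
    have [d [t [tP et]]] := locP a'.
    exists (t * (u * v)); split; first by do 2![apply: Localization.notin_mul => //].
    exists ((d * v) * b + (t * u) * c); split.
      by rewrite !(rmorphM, rmorphD) /= -et -eb -ec; ring.
    by case: (in_ideal_prop s) => _; apply=> //; apply: ideal_propM (in_ideal_prop s) _.
  have [x xs|u [uP [b [e sb]]]] := in_ideal_min Iid _ H.
    have /mapP[b bs ->] := xs; exists 1; rewrite idealr1; split=> //.
    by exists b; rewrite rmorph1 mul1r; split=> //; apply: mem_in_ideal.
  exists u; split=> //; exists b; split=> //.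
  by rewrite rmorphB rmorphM /= e subrr.
have [z uz] := loc_unit uP.
have -> : loc a = z * loc (u * a) by rewrite rmorphM /= mulrA [z * _]mulrC uz mul1r.
apply: ideal_propM; first exact: in_ideal_prop.
have Iid : ideal_prop (fun b => in_ideal (map loc s) (loc b)).
  split=> [|c x y]; first by rewrite rmorph0; case: (in_ideal_prop (map loc s)).
  by rewrite rmorphD rmorphM /=; apply: (in_ideal_prop (map loc s)).2.
apply: in_ideal_min Iid _ _ ua => x xs.
by apply: mem_in_ideal; apply: map_f.
Qed.

(* [s] is a sequence in P which becomes regular in the localization at P. *)
Definition regular_at (s : seq R) := {subset s <= P} /\
  forall j, (j < size s)%N -> forall y : R, in_ideal (take j s) (s`_j * y) ->
  exists2 c, c \notin P & in_ideal (take j s) (c * y).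

Lemma regular_at_loc (s : seq R) : regular_at s -> has_local_regular_sequence L (size s).
Proof.
move=> [sP sreg]; exists (map loc s); split; first by rewrite size_map.
  by move=> _ /mapP[a /sP aP ->]; apply: loc_nonunit.
split=> [j|]; last first.
  rewrite -(rmorph1 loc) loc_in_ideal => -[u]; rewrite mulr1 => /negP uP su; apply: uP.
  exact: (in_ideal_min (prime_prop P) sP su).
rewrite size_map => js y; rewrite (nth_map 0) // -map_take.
have [a [t [tP e]]] := locP y => H.
have /loc_in_ideal[u uP] : in_ideal (map loc (take j s)) (loc (s`_j * a)).
  by rewrite rmorphM /= -e mulrCA; apply: ideal_propM (in_ideal_prop _) _.
rewrite mulrCA => /(sreg j js)[c cP]; rewrite mulrA => scu.
have [z tz] := loc_unit tP.
have -> : y = z * loc a by rewrite -e mulrA [z * _]mulrC tz mul1r.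
apply: ideal_propM (in_ideal_prop _) _; apply/loc_in_ideal.
by exists (c * u) => //; apply: Localization.notin_mul.
Qed.

(** Primes are contracted along [loc]. Inclusions stay strict because each element of L has a unit
    multiple in the image of R. *)
Lemma loc_chain d : has_prime_chain L d ->
  exists C : nat -> prime_idealr R,
    (forall i, (i < d)%N -> prime_ltn (C i) (C i.+1)) /\ forall i, {subset C i <= P}.
Proof.
move=> [C CS].
have H i : exists Q : prime_idealr R, forall a, (a \in Q) = (loc a \in C i).
  have [||a b|Q QE] := @prime_idealr_of R (fun a => loc a \in C i).
  - split=> [|a x y xC yC]; first by rewrite rmorph0 idealr0.
    by rewrite rmorphD rmorphM rpredD // idealMr.
  - by rewrite rmorph1 idealr1.
  - by rewrite rmorphM prime_idealrM => /orP.
  by exists Q => a; rewrite QE; apply: asboolb.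
have [D DE] := choice H; exists D; split=> [i id|i a]; last first.
  rewrite DE; apply: contraLR => aP; apply/negP => aC.
  have [x ax] := loc_unit aP; suff : 1 \in C i by rewrite idealr1.
  by rewrite -ax mulrC idealMr.
have [sub [x xC xN]] := CS i id; split=> [a|]; first by rewrite !DE; apply: sub.
have [a [s [sP e]]] := locP x; exists a; rewrite DE -e; first exact: idealMr.
rewrite prime_idealrM negb_or xN andbT; apply/negP => sC.
have [y sy] := loc_unit sP; suff : 1 \in C i by rewrite idealr1.
by rewrite -sy mulrC idealMr.
Qed.

Lemma chain_loc d (C : nat -> prime_idealr R) :
  (forall i, (i < d)%N -> prime_ltn (C i) (C i.+1)) ->
  (forall i, (i <= d)%N -> {subset C i <= P}) -> has_prime_chain L d.
Proof.
move=> CS CP.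
(* [choice] asks for a prime at every index; past d, where C i need not lie in P, any prime of L
   will do. *)
have H i : exists Q : prime_idealr L, (i <= d)%N -> forall a, (loc a \in Q) = (a \in C i).
  have [id|] := boolP (i <= d)%N; last first.
    have [|//|x y|x|Q _] := prime_disjoint (R := L) (I := fun x => x = 0) (M := fun x => x = 1).
    - by split=> // a x y -> ->; rewrite mulr0 addr0.
    - by move=> -> ->; rewrite mulr1.
    - by move=> -> /esym/eqP; rewrite (negPf (oner_neq0 _)).
    by exists Q.
  have CPi := CP _ id.
  pose q x := exists s a, [/\ s \notin P, a \in C i & loc s * x = loc a].
  have qE a : q (loc a) <-> a \in C i.
    split=> [[s [b [sP bC]]]|aC]; last first.
      by exists 1, a; rewrite idealr1 rmorph1 mul1r.
    move=> /eqP; rewrite -subr_eq0 -rmorphM -rmorphB => /eqP/loc_eq0[u uP].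
    move=> /eqP; rewrite mulrBr subr_eq0 => /eqP e.
    have : u * (s * a) \in C i by rewrite e idealMr.
    by rewrite !prime_idealrM => /orP[/CPi|/orP[/CPi|//]]; rewrite (negPf uP, negPf sP).
  have [||x y|Q QE] := @prime_idealr_of L q.
  - split; first by rewrite -(rmorph0 loc); apply/qE; rewrite idealr0.
    move=> a x y [s [b [sP bC e]]] [t [c [tP cC f]]].
    have [d' [u [uP g]]] := locP a.
    exists (u * (s * t)), ((d' * t) * b + (u * s) * c); split.
    + by do 2![apply: Localization.notin_mul => //].
    + by rewrite rpredD // idealMr.
    + by rewrite !(rmorphM, rmorphD) /= -e -f -g; ring.
  - by rewrite -(rmorph1 loc) qE idealr1.
  - have [a [s [sP e]]] := locP x; have [b [t [tP f]]] := locP y.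
    move=> [u [c [uP cC g]]].
    have : u * a * b \in C i.
      apply/qE; exists 1, (s * t * c); split; rewrite ?idealr1 ?idealMr //.
      by rewrite !rmorphM /= rmorph1 -e -f -g; ring.
    rewrite !prime_idealrM => /orP[/orP[/CPi|aC]|bC]; first by rewrite (negPf uP).
      by left; exists s, a.
    by right; exists t, b.
  exists Q => _ a; rewrite QE; apply/asboolP/idP; by case: (qE a).
have [D DE] := choice H; exists D => i id.
have [sub [a aC aN]] := CS i id; split=> [x|]; last first.
  by exists (loc a); rewrite DE // ltnW.
have [b [s [sP e]]] := locP x => xD.
have : loc b \in D i by rewrite -e idealMr.
rewrite DE 1?ltnW // => /sub; rewrite -(DE i.+1) // -e prime_idealrM => /orP[|//].
by rewrite DE // => /(CP _ id); rewrite (negPf sP).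
Qed.

End LocalizationMap.

(** A regular sequence gives a chain of primes of its own length, so the bound on chains also bounds
    the depth, and s attains both bounds. *)
Lemma cohen_macaulay_at (R : comNzRingType) (P : prime_idealr R) (s : seq R) :
  regular_at P s ->
  (forall d, has_prime_chain (localization P) d -> (d <= size s)%N) ->
  has_krull_dim (localization P) (size s) /\ has_depth (localization P) (size s).
Proof.
move=> sreg bound; have H := regular_at_loc sreg; split; split=> //.
  by case: H => t [<- _ /regular_sequence_chain].
by move=> r [t [<- _ /regular_sequence_chain]]; apply: bound.
Qed.

Lemma cohen_macaulay_serre r (R : comNzRingType) :
  cohen_macaulay_ring R -> serre_condition r R.
Proof. by move=> H P; have [d dimd depthd] := H P; exists d, d; rewrite geq_minr. Qed.

(** * Algebraic independence and growth *)

(** Exponent vectors of length u with entries below N, as nested pairs so that the first exponent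
    splits off. *)
Fixpoint midx (N u : nat) : finType :=
  if u is u'.+1 then ('I_N * midx N u')%type : finType else unit.

Lemma card_midx N u : #|midx N u| = (N ^ u)%N.
Proof. by elim: u => [|u IH]; rewrite ?card_unit // card_prod IH card_ord expnS. Qed.

Lemma sum_midxS (V : nmodType) N u (F : midx N u.+1 -> V) :
  \sum_e F e = \sum_(j < N) \sum_(e : midx N u) F (j, e).
Proof. by rewrite pair_bigA; apply: eq_bigr => -[]. Qed.

Lemma sum_midx0 (V : nmodType) N (F : midx N 0 -> V) : \sum_e F e = F tt.
Proof. by rewrite (bigD1 tt) //= big1 ?addr0 // => -[]. Qed.

Section AlgebraicIndependence.
Variables (k : fieldType) (R : comNzRingType) (iota : {rmorphism k -> R}).
Implicit Types (I : R -> Prop) (t : seq R) (P Q : prime_idealr R).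

Fixpoint mono N u t : midx N u -> R :=
  if u is u'.+1 then fun e : midx N u'.+1 => head 0 t ^+ e.1 * @mono N u' (behead t) e.2
  else fun=> 1.

Definition algind_size I u t :=
  forall N (c : midx N u -> k), I (\sum_e iota (c e) * mono t e) -> forall e, c e = 0.

(* The entries of [t] are algebraically independent over k modulo I. *)
Definition algind I t := algind_size I (size t) t.

Lemma algind_nil I : ideal_prop I -> ~ I 1 -> algind I [::].
Proof.
move=> Iid I1 N c; rewrite sum_midx0 /= mulr1 => cI [].
apply/eqP/negPn/negP => c0; apply: I1.
by rewrite -(rmorph1 iota) -(mulVf c0) rmorphM; apply: ideal_propM.
Qed.

Lemma algind_sub I (J : R -> Prop) t : (forall x, I x -> J x) -> algind J t -> algind I t.
Proof. by move=> IJ H N c /IJ; apply: H. Qed.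

(** Read a relation modulo Q as a polynomial in y with coefficients [w j]. If all coefficients
    before j vanish, the power y^j cancels because y is not in the prime Q; as y lies in P, what
    remains says that [w j] is in P, and the independence of t applies. *)
Lemma algind_cons P Q y t : {subset Q <= P} -> y \in P -> y \notin Q ->
  algind (fun x => x \in P) t -> algind (fun x => x \in Q) (y :: t).
Proof.
move=> QP yP yQ tind N c; rewrite sum_midxS.
pose w (j : 'I_N) := \sum_e iota (c (j, e)) * mono t e.
rewrite (eq_bigr (fun j : 'I_N => y ^+ j * w j)) => [sQ|j _]; last first.
  by rewrite /w mulr_sumr; apply: eq_bigr => e _ /=; rewrite mulrCA.
suff H (j : 'I_N) : forall e, c (j, e) = 0 by case=> j e; apply: H.
have [n] := ubnP j; elim: n j => // n IH j; rewrite ltnS => jn.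
apply: (tind N); rewrite -/(w j).
(* The terms above j after division by y^j; each keeps a factor y and so lies in P. *)
pose r := \sum_(l < N | (j < l)%N) y ^+ (l - j) * w l.
have : y ^+ j * (w j + r) \in Q.
  rewrite mulrDr [X in _ + X]mulr_sumr; move: sQ.
  rewrite (bigID (fun l : 'I_N => (l < j)%N)) /= big1 ?add0r; last first.
    move=> l lj; rewrite /w big1 ?mulr0 // => e _.
    by rewrite (IH l (leq_trans lj jn)) rmorph0 mul0r.
  rewrite (bigD1 j) ?ltnn //=.
  suff -> : \sum_(l < N | (j < l)%N) y ^+ j * (y ^+ (l - j) * w l) =
            \sum_(l < N | ~~ (l < j)%N && (l != j)) y ^+ l * w l by [].
  apply: eq_big => l; first by rewrite -leqNgt ltn_neqAle andbC eq_sym.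
  by move=> jl; rewrite mulrA -exprD subnKC // ltnW.
have rP : r \in P.
  apply: (ideal_prop_sum _ (prime_prop P)) => l jl.
  by rewrite -(subnSK jl) exprS -mulrA mulrC idealMr.
rewrite prime_idealrM => /orP[|/QP wrP]; last first.
  by rewrite -[w j](addrK r) rpredB.
suff /negPf -> : y ^+ j \notin Q by [].
elim: (nat_of_ord j) => [|i Hi]; first by rewrite expr0 idealr1.
by rewrite exprS prime_idealrM negb_or yQ.
Qed.

Lemma algind_chain d (C : nat -> prime_idealr R) P t :
  (forall i, (i < d)%N -> prime_ltn (C i) (C i.+1)) ->
  {subset C d <= P} -> algind (fun x => x \in P) t ->
  exists t', size t' = (d + size t)%N /\ algind (fun x => x = 0) t'.
Proof.
elim: d P t => [|d IH] P t CS CP tP.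
  exists t; split=> //; apply: algind_sub tP => x ->; exact: idealr0.
have [sub [y yC yN]] := CS d (leqnn _).
have ty : algind (fun x => x \in C d) (y :: t).
  apply: (algind_cons sub yC yN); exact: algind_sub tP.
have [i id||t' [st' H]] := IH (C d) _ _ _ ty; [|by []|].
  by apply: CS; rewrite ltnW.
by exists t'; rewrite st' /= addnS.
Qed.

(* The Hilbert function of R over k grows like a polynomial of degree m; [F] is
   the filtration of R by degree. *)
Definition growth_le (m : nat) := exists (F : nat -> R -> Prop) (C : nat),
  [/\ F 0%N 1, forall x, exists M, F M x,
      forall M M' x, (M <= M')%N -> F M x -> F M' x,
      forall M M' x y, F M x -> F M' y -> F (M + M')%N (x * y)
    & forall M (J : finType) (v : J -> R), (forall i, F M (v i)) ->
        (forall c : J -> k, \sum_i iota (c i) * v i = 0 -> forall i, c i = 0) ->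
        (#|J| <= C * M.+1 ^ m)%N].

(** With u = [size t], the N^u monomials with exponents below N are independent and lie in degree u
    N D, so N^u is at most C (u N D + 1)^m for every N. This is impossible when u > m. *)
Lemma algind_growth m t : growth_le m -> algind (fun x => x = 0) t -> (size t <= m)%N.
Proof.
move=> [F [C [F1 Fex Fmono FM Fcard]]] tind.
have [D FD] : exists D, forall x, x \in t -> F D x.
  elim: t {tind} => [|x t [D FD]]; first by exists 0%N.
  have [M FMx] := Fex x; exists (maxn D M) => y.
  rewrite inE => /orP[/eqP -> {y}|/FD].
    by apply: Fmono FMx; rewrite leq_maxr.
  by apply: Fmono; rewrite leq_maxl.
have FX x n : F D x -> F (n * D)%N (x ^+ n).
  by move=> Fx; elim: n => // n IH; rewrite exprS mulSn; apply: FM.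
have Fmon N (e : midx N (size t)) : F (size t * (N * D))%N (mono t e).
  elim: t FD {tind} e => //= x t IH FD [j e] /=; rewrite mulSn.
  apply: FM; last by apply: IH => y yt; apply: FD; rewrite inE yt orbT.
  apply: Fmono (FX _ j _); last by apply: FD; rewrite inE eqxx.
  by rewrite leq_mul2r ltnW ?orbT.
(* As u N D + 1 <= (u D + 1) N, the bound is at most K N^m with K independent of N; N = K + 1
   contradicts N^(m+1) <= K N^m. *)
pose u := size t; pose K := (C * (u * D).+1 ^ m)%N; pose N := K.+1.
rewrite leqNgt; apply/negP => um.
have := Fcard _ _ _ (Fmon N) (tind N); rewrite card_midx -/u => H.
have : (N * N ^ m <= K * N ^ m)%N.
  rewrite -expnS; apply: leq_trans (leq_pexp2l (ltn0Sn _) um) _.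
  apply: leq_trans H _; rewrite /K -mulnA leq_mul2l -expnMn; apply/orP; right.
  have [->|m0] := posnP m; first by rewrite !expn0.
  by rewrite leq_exp2r // mulSn -mulnA [(D * N)%N]mulnC -add1n leq_add2r.
by rewrite leq_pmul2r ?expn_gt0 // ltnn.
Qed.

Lemma chain_bound m d (C : nat -> prime_idealr R) P t : growth_le m ->
  (forall i, (i < d)%N -> prime_ltn (C i) (C i.+1)) ->
  {subset C d <= P} -> algind (fun x => x \in P) t -> (d + size t <= m)%N.
Proof.
move=> gm CS CP tP; have [t' [<- t'ind]] := algind_chain CS CP tP.
exact: algind_growth t'ind.
Qed.

End AlgebraicIndependence.

Lemma algind_eq (k : fieldType) (R : comNzRingType) (iota iota' : {rmorphism k -> R})
    (I : R -> Prop) t : iota =1 iota' -> algind iota I t -> algind iota' I t.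
Proof.
move=> e H N c cI; apply: (H N); move: cI; congr (I _).
by apply: eq_bigr => i _; rewrite e.
Qed.

Section RegularPrimes.
Variables (k : fieldType) (R : comNzRingType) (iota : {rmorphism k -> R}).

(* When the growth of R is at most m, a chain of primes below P has length at
   most m - size t = size s, so that R is Cohen-Macaulay at P. *)
Definition regular_primes (m : nat) := forall P : prime_idealr R, exists t s,
  [/\ (size t + size s)%N = m, algind iota (fun x => x \in P) t & regular_at P s].

Lemma regular_primes_CM m : growth_le iota m -> regular_primes m -> cohen_macaulay_ring R.
Proof.
move=> gm reg P; have [t [s [ts tP sP]]] := reg P; 
have [|dimP depthP] := cohen_macaulay_at sP; last by exists (size s).
move=> d /loc_chain[C [CS CP]].
by rewrite -(leq_add2r (size t)) [X in (_ <= X)%N]addnC ts; exact: (chain_bound gm CS (CP d) tP).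
Qed.

End RegularPrimes.
(** * Polynomial extensions *)

Section IndependenceMap.
Variables (k : fieldType) (R S : comNzRingType).
Variables (iota : {rmorphism k -> R}) (f : {rmorphism R -> S}).

Lemma mono_map N u t (e : midx N u) : mono (map f t) e = f (mono t e).
Proof.
elim: u t e => [|u IH] t e /=; first by rewrite rmorph1.
rewrite rmorphM rmorphXn -IH behead_map; congr (_ ^+ _ * _).
by case: t => //=; rewrite rmorph0.
Qed.

Lemma algind_map (I : S -> Prop) t :
  algind iota (fun x => I (f x)) t -> algind (f \o iota) I (map f t).
Proof.
move=> H N; rewrite size_map => c Ic; apply: (H N c).
rewrite rmorph_sum /=; move: Ic; congr (I _); apply: eq_bigr => e _.
by rewrite mono_map rmorphM.
Qed.

End IndependenceMap.

Section IndependencePoly.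
Variables (k : fieldType) (A : comNzRingType) (iota : {rmorphism k -> A}).

(** The coefficient of X^j in a relation is a relation among t modulo I. *)
Lemma algind_polyX (I : A -> Prop) (J : {poly A} -> Prop) t :
  (forall F i, J F -> I F`_i) -> algind iota I t ->
  algind (polyC \o iota) J ('X :: map polyC t).
Proof.
move=> JI tI N; rewrite /= size_map => c.
pose w (j : 'I_N) := \sum_(e : midx N (size t)) iota (c (j, e)) * mono t e.
rewrite (sum_midxS (u := size t)) (eq_bigr (fun j : 'I_N => w j *: 'X^j)) => [H|j _].
  case=> j e; apply: (tI N (fun e => c (j, e))).
  have := JI _ j H; rewrite coef_sum (bigD1 j) //= coefZ coefXn eqxx mulr1.
  rewrite big1 ?addr0 // => l lj.
  by rewrite coefZ coefXn (inj_eq val_inj) eq_sym (negPf lj) mulr0.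
rewrite -mul_polyC rmorph_sum mulr_suml; apply: eq_bigr => e _ /=.
by rewrite mono_map mulrCA mulrC rmorphM.
Qed.

End IndependencePoly.

(** * Regular sequences in a polynomial ring A[X] *)

Section PolynomialExtension.
Variable A : comNzRingType.
Implicit Types (I : A -> Prop) (s : seq A) (F y : {poly A}).

(* If F y has its coefficients in I, multiplying y by the leading coefficient
   of F and removing the top term of y decreases its degree. *)
Lemma coef_mul_ideal I F y : ideal_prop I -> (forall i, I (F * y)`_i) ->
  exists N, forall i, I (lead_coef F ^+ N * y`_i).
Proof.
move=> Iid; have [n] := ubnP (size y); elim: n y => // n IH y; rewrite ltnS => yn FyI.
have [y0|y0] := eqVneq y 0.
  by exists 0%N => i; rewrite y0 coef0 mulr0; case: Iid.
set c := lead_coef F; set d := (size y).-1.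
have Ic : I (c * y`_d).
  by rewrite -[y`_d]/(lead_coef y) mul_lead_coef.
pose z := c *: (y - y`_d *: 'X^d).
have [||N HN] := IH z.
- apply: leq_trans yn; apply: leq_ltn_trans (size_scale_leq _ _) _.
  rewrite -[X in (_ < X)%N]prednK ?lt0n ?size_poly_eq0 // ltnS.
  apply/leq_sizeP => j dj; rewrite coefB coefZ coefXn.
  have [->|jd] := eqVneq j d; first by rewrite mulr1 subrr.
  rewrite mulr0 subr0 nth_default // -[X in (X <= _)%N]prednK ?lt0n ?size_poly_eq0 //.
  by rewrite ltn_neqAle eq_sym jd.
- move=> i; rewrite /z -scalerAr mulrBr -scalerAr scalerBr coefB !coefZ.
  apply: ideal_propB => //; first exact: ideal_propM.
  by rewrite mulrA mulrC; apply: ideal_propM.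
exists N.+1 => i; rewrite exprSr -mulrA.
have -> : c * y`_i = z`_i + (i == d)%:R * (c * y`_d).
  by rewrite /z coefZ coefB coefZ coefXn; ring.
rewrite mulrDr; apply: ideal_propD => //.
by do 2![apply: ideal_propM => //].
Qed.

Lemma coef_ideal_prop I : ideal_prop I -> ideal_prop (fun F : {poly A} => forall i, I F`_i).
Proof.
move=> Iid; split=> [i|F y z yI zI i]; first by rewrite coef0; case: Iid.
rewrite coefD coefM; apply: ideal_propD => //.
by apply: ideal_prop_sum => // j _; apply: ideal_propM.
Qed.

Lemma in_ideal_polyC s F : in_ideal (map polyC s) F <-> forall i, in_ideal s F`_i.
Proof.
split=> [|H].
  apply: (in_ideal_min (I := fun F => forall i, in_ideal s F`_i)).
    exact/coef_ideal_prop/in_ideal_prop.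
  move=> _ /mapP[a as_ ->] i.
  rewrite coefC; case: eqP => _; first exact: mem_in_ideal.
  by case: (in_ideal_prop s).
have sC a : in_ideal s a -> in_ideal (map polyC s) a%:P.
  apply: (in_ideal_min (I := fun a => in_ideal (map polyC s) a%:P)) => [|x xs].
    split=> [|b x y]; first by rewrite polyC0; case: (in_ideal_prop (map polyC s)).
    by rewrite polyCD polyCM; apply: (in_ideal_prop (map polyC s)).2.
  by apply: mem_in_ideal; apply: map_f.
rewrite -[F]coefK poly_def; apply: (ideal_prop_sum _ (in_ideal_prop _)) => i _.
by rewrite -mul_polyC mulrC; apply: ideal_propM (in_ideal_prop _) _; apply: sC.
Qed.

Variables (P : prime_idealr {poly A}) (p : prime_idealr A).
Hypothesis pP : forall a, (a \in p) = (a%:P \in P).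

(** A leading term with coefficient in p lies in P, so it can be removed without leaving P; the
    coefficient outside p survives each removal. *)
Lemma lead_coef_notin F i : F \in P -> F`_i \notin p ->
  exists2 G, G \in P & lead_coef G \notin p.
Proof.
have [n] := ubnP (size F); elim: n F => // n IH F; rewrite ltnS => Fn FP Fi.
have [Fp|] := boolP (lead_coef F \in p); last by exists F.
have F0 : F != 0 by apply: contraNneq Fi => ->; rewrite coef0 idealr0.
set d := (size F).-1; apply: (IH (F - (lead_coef F)%:P * 'X^d)).
- apply: leq_trans Fn.
  rewrite -[X in (_ < X)%N]prednK ?lt0n ?size_poly_eq0 // ltnS.
  apply/leq_sizeP => j dj; rewrite coefB coefCM coefXn.
  have [->|jd] := eqVneq j d; first by rewrite mulr1 subrr.
  rewrite mulr0 subr0 nth_default // -[X in (X <= _)%N]prednK ?lt0n ?size_poly_eq0 //.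
  by rewrite ltn_neqAle eq_sym jd.
- by rewrite rpredB // mulrC idealMr // -pP.
rewrite coefB coefCM; apply: contra Fi => H.
by rewrite -(subrK (lead_coef F * ('X^d)`_i) F`_i) rpredD // mulrC idealMr.
Qed.

Lemma regular_at_polyC s : regular_at p s -> regular_at P (map polyC s).
Proof.
move=> [sp sreg]; split=> [_ /mapP[a /sp ap ->]|j]; first by rewrite -pP.
rewrite size_map => js y; rewrite -map_take (nth_map 0) // => /in_ideal_polyC H.
have [i|c cP] := choice (P := fun i c => c \notin p /\ in_ideal (take j s) (c * y`_i)) _.
  have [|c cp yi] := sreg j js y`_i; first by rewrite -coefCM.
  by exists c.
(* One multiplier for all coefficients of y: the product of those found for each. *)
exists (\prod_(i < size y) c i)%:P.
  rewrite -pP; elim/big_ind: _ => [|a b|i _]; first by rewrite idealr1.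
    by rewrite prime_idealrM negb_or => -> ->.
  by case: (cP i).
apply/in_ideal_polyC => i; rewrite coefCM.
have [iy|yi] := ltnP i (size y); last first.
  by rewrite nth_default // mulr0; case: (in_ideal_prop (take j s)).
rewrite (bigD1 (Ordinal iy)) //= mulrAC mulrC; apply: ideal_propM (in_ideal_prop _) _.
by case: (cP i).
Qed.

(** If F y lies in the ideal of s, [coef_mul_ideal] brings y into it after multiplication by a power
    of the leading coefficient of F, and that power is outside P. *)
Lemma regular_at_rcons s F : F \in P -> lead_coef F \notin p ->
  regular_at p s -> regular_at P (rcons (map polyC s) F).
Proof.
move=> FP Fp sp; have [sP sreg] := regular_at_polyC sp; split=> [x|j].
  by rewrite mem_rcons inE => /orP[/eqP ->|/sP].
rewrite size_rcons size_map ltnS leq_eqVlt => /orP[/eqP ->|js] y; last first.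
  have js' : (j < size (map polyC s))%N by rewrite size_map.
  by rewrite nth_rcons js' -cats1 takel_cat 1?ltnW //; apply: sreg.
rewrite nth_rcons size_map ltnn eqxx -cats1 take_size_cat ?size_map //.
move=> /in_ideal_polyC/(coef_mul_ideal (in_ideal_prop _))[N HN].
exists (lead_coef F ^+ N)%:P; last by apply/in_ideal_polyC => i; rewrite coefCM.
rewrite -pP; elim: (N) => [|M IH]; first by rewrite expr0 idealr1.
by rewrite exprS prime_idealrM negb_or Fp.
Qed.

End PolynomialExtension.

(** Let [p0] be the contraction of P to A. If all elements of P have their coefficients in [p0],
    then X joins the independent sequence; otherwise P has an element with leading coefficient
    outside [p0], which joins the regular one. *)
Lemma regular_primes_poly (k : fieldType) (A : comNzRingType)
    (iota : {rmorphism k -> A}) m :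
  regular_primes iota m -> regular_primes (polyC \o iota) m.+1.
Proof.
move=> H P.
have [||x y|p0 pE] := @prime_idealr_of A (fun a => a%:P \in P).
- split=> [|a x y]; first by rewrite polyC0 idealr0.
  by rewrite polyCD polyCM => xP yP; rewrite rpredD // idealMr.
- by rewrite polyC1 idealr1.
- by rewrite polyCM prime_idealrM => /orP.
have pP a : (a \in p0) = (a%:P \in P) by rewrite pE asboolb.
have [t [s [ts tp sp]]] := H p0.
have [Pp|] := EM (forall F i, F \in P -> F`_i \in p0).
  exists ('X :: map polyC t), (map polyC s); split.
  - by rewrite /= !size_map addSn ts.
  - exact: algind_polyX tp.
  - exact: regular_at_polyC sp.
move=> /existsNP[F /existsNP[i /not_implyP[FP /negP Fi]]].
have [G GP Gp] := lead_coef_notin pP FP Fi.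
exists (map polyC t), (rcons (map polyC s) G); split.
- by rewrite size_rcons !size_map addnS ts.
- by apply: algind_map; apply: algind_sub tp => x; rewrite pP.
- exact: regular_at_rcons sp.
Qed.

Lemma regular_primes_field (k : fieldType) : regular_primes (idfun : {rmorphism k -> k}) 0.
Proof.
move=> P; exists [::], [::]; split=> //.
by apply: algind_nil; [exact: prime_prop|rewrite idealr1].
Qed.

Lemma regular_primes_iso (k : fieldType) (A B : comNzRingType)
    (iota : {rmorphism k -> A}) (f : {rmorphism A -> B}) m :
  bijective f -> regular_primes iota m -> regular_primes (f \o iota) m.
Proof.
move=> [g fK gK] H P.
have [||x y|p0 pE] := @prime_idealr_of A (fun a => f a \in P).
- split=> [|a x y]; first by rewrite rmorph0 idealr0.
  by rewrite rmorphD rmorphM => xP yP; rewrite rpredD // idealMr.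
- by rewrite rmorph1 idealr1.
- by rewrite rmorphM prime_idealrM => /orP.
have pP a : (a \in p0) = (f a \in P) by rewrite pE asboolb.
have [t [s [ts tp [sp sreg]]]] := H p0.
have in_ideal_f (r : seq A) x : in_ideal r x -> in_ideal (map f r) (f x).
  apply: (in_ideal_min (I := fun x => in_ideal (map f r) (f x))) => [|y yr].
    split=> [|b y z]; first by rewrite rmorph0; case: (in_ideal_prop (map f r)).
    by rewrite rmorphD rmorphM; apply: (in_ideal_prop (map f r)).2.
  by apply: mem_in_ideal; apply: map_f.
have in_ideal_g (r : seq A) x : in_ideal (map f r) x -> in_ideal r (g x).
  apply: (in_ideal_min (I := fun x => in_ideal r (g x))) => [|_ /mapP[y yr ->]].
    split=> [|b y z]; first by rewrite -(rmorph0 f) fK; case: (in_ideal_prop r).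
    have -> : g (b * y + z) = g b * g y + g z.
      by apply: (can_inj fK); rewrite gK rmorphD rmorphM /= !gK.
    exact: (in_ideal_prop r).2.
  by rewrite fK; apply: mem_in_ideal.
exists (map f t), (map f s); split; first by rewrite !size_map.
  by apply: algind_map; apply: algind_sub tp => x; rewrite pP.
split=> [_ /mapP[a /sp ap ->]|j]; first by rewrite -pP.
rewrite size_map => js y; rewrite -map_take (nth_map 0) // -{1}[y]gK -rmorphM.
move=> /in_ideal_g; rewrite fK => /(sreg j js)[c cp cy].
by exists (f c); rewrite -?pP // -[y]gK -rmorphM; apply: in_ideal_f.
Qed.

Lemma regular_primes_eq (k : fieldType) (A : comNzRingType)
    (iota iota' : {rmorphism k -> A}) m :
  iota =1 iota' -> regular_primes iota m -> regular_primes iota' m.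
Proof.
move=> e H P; have [t [s [ts tP sP]]] := H P; exists t, s; split=> //.
exact: algind_eq tP.
Qed.

Lemma mpoly_rmorph_ext n (k : fieldType) (S : comNzRingType)
    (f g : {rmorphism {mpoly k[n]} -> S}) :
  (forall c, f c%:MP = g c%:MP) -> (forall i, f 'X_i = g 'X_i) -> f =1 g.
Proof.
move=> fgC fgX p; rewrite [p]mpolyE !rmorph_sum; apply: eq_bigr => m _ /=.
rewrite -mul_mpolyC !rmorphM fgC mpolyXE_id !rmorph_prod; congr (_ * _).
by apply: eq_bigr => i _; rewrite !rmorphXn /= fgX.
Qed.

(** * Splitting off the last variable of a polynomial ring *)

Section MpolySucc.
Variables (k : fieldType) (n : nat).

Let muniX (i : 'I_n.+1) : {poly {mpoly k[n]}} :=
  if unlift ord_max i is Some j then ('X_j)%:P else 'X.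
Let f : {rmorphism {mpoly k[n.+1]} -> {poly {mpoly k[n]}}} :=
  mmap (polyC \o @mpolyC n k) muniX.
Let g : {rmorphism {poly {mpoly k[n]}} -> {mpoly k[n.+1]}} :=
  horner_eval ('X_ord_max : {mpoly k[n.+1]}) \o map_poly (@mwiden n k).

Let fC c : f c%:MP = c%:MP%:P. Proof. exact: mmapC. Qed.
Let fX i : f 'X_i = muniX i. Proof. by rewrite /f /= mmapX mmap1U. Qed.
Let gC p : g p%:P = mwiden p.
Proof. by rewrite /g /= /horner_eval map_polyC hornerC. Qed.
Let gX : g 'X = 'X_ord_max.
Proof. by rewrite /g /= /horner_eval map_polyX hornerX. Qed.
Let widenE (i : 'I_n) : widen_ord (leqnSn n) i = lift ord_max i.
Proof. by apply: val_inj; rewrite /= /bump leqNgt ltn_ord. Qed.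
Let mwidenXU (i : 'I_n) : mwiden ('X_i : {mpoly k[n]}) = 'X_(lift ord_max i).
Proof. by rewrite mwidenX mnmwiden1 widenE. Qed.

Let fgK : cancel f g.
Proof.
apply: (mpoly_rmorph_ext (f := g \o f) (g := idfun)) => [c|i].
  by change (g (f c%:MP) = c%:MP); rewrite fC gC mwidenC.
change (g (f 'X_i) = 'X_i); rewrite fX /muniX; case: unliftP => [j|] ->; last exact: gX.
by rewrite gC mwidenXU.
Qed.

Let gfK : cancel g f.
Proof.
have fgC p : f (g p%:P) = p%:P.
  rewrite gC; move: p; apply: (mpoly_rmorph_ext (f := f \o @mwiden n k) (g := polyC)) => [c|i].
    by change (f (mwiden c%:MP) = c%:MP%:P); rewrite mwidenC fC.
  by change (f (mwiden 'X_i) = ('X_i)%:P); rewrite mwidenXU fX /muniX liftK.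
move=> p; rewrite -[p]coefK poly_def [g _]rmorph_sum rmorph_sum; apply: eq_bigr => i _.
rewrite -mul_polyC !rmorphM fgC !rmorphXn gX fX /muniX.
by case: unliftP => [j /eqP|//]; rewrite (negPf (neq_lift _ _)).
Qed.

Lemma regular_primes_mpolyS :
  regular_primes (@mpolyC n k) n -> regular_primes (@mpolyC n.+1 k) n.+1.
Proof.
move=> /regular_primes_poly/(regular_primes_iso (f := g)) H.
apply: (regular_primes_eq _ (H _)) => [c|].
  by change (g c%:MP%:P = c%:MP); rewrite gC mwidenC.
exact: Bijective gfK fgK.
Qed.

End MpolySucc.

Lemma regular_primes_mpoly (k : fieldType) n : regular_primes (@mpolyC n k) n.
Proof.
elim: n => [|n IH]; last exact: regular_primes_mpolyS.
have H : regular_primes (@mpolyC 0 k \o idfun) 0.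
  apply: regular_primes_iso; last exact: regular_primes_field.
  exists (@mcoeff 0 k 0%MM); [exact: mpolyCK|exact: mpolyKC].
exact: regular_primes_eq H.
Qed.

(** * Stanley-Reisner rings *)

Section Restriction.
Variables (k : fieldType) (n : nat).
Implicit Types (F G : {set 'I_n}) (f : {mpoly k[n]}) (m : 'X_{1..n}).

Definition msuppset m : {set 'I_n} := [set j | m j != 0%N].

(** The quotient map onto the polynomial ring in the variables of F, realised as an endomorphism so
    that restrictions to different sets compose. *)
Definition restr F : {mpoly k[n]} -> {mpoly k[n]} :=
  mmap (@mpolyC n k) (fun j => if j \in F then 'X_j else 0).

HB.instance Definition _ F :=
  GRing.RMorphism.copy (restr F) (mmap (@mpolyC n k) (fun j => if j \in F then 'X_j else 0)).

Lemma restrC F c : restr F c%:MP = c%:MP.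
Proof. exact: mmapC. Qed.

Lemma restrXU F j : restr F 'X_j = if j \in F then 'X_j else 0.
Proof. by rewrite /restr /= mmapX mmap1U. Qed.

Lemma restrX F m : restr F 'X_[m] = if msuppset m \subset F then 'X_[m] else 0.
Proof.
rewrite mpolyXE_id rmorph_prod /=; case: ifPn => [/subsetP mF|/subsetPn[j]].
  apply: eq_bigr => j _; rewrite rmorphXn /= restrXU.
  case: ifPn => // jF; have [-> //|mj] := eqVneq (m j) 0%N.
  by case/negP: jF; apply: mF; rewrite inE.
rewrite inE => mj jF; rewrite (bigD1 j) //= rmorphXn /= restrXU (negPf jF).
by rewrite expr0n (negPf mj) mul0r.
Qed.

Lemma mcoeff_restr F f m : (restr F f)@_m = if msuppset m \subset F then f@_m else 0.
Proof.
rewrite {1}[f]mpolyE rmorph_sum /= raddf_sum /=.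
transitivity (\sum_(l <- msupp f) (if msuppset m \subset F then f@_l * (l == m)%:R else 0)).
  apply: eq_bigr => l _; rewrite -mul_mpolyC rmorphM /= restrC restrX.
  rewrite mcoeffCM; have [->|lm] := eqVneq l m.
    by case: ifP => _; rewrite ?mcoeffX ?eqxx ?mcoeff0 ?mulr0.
  by rewrite mulr0; case: ifP => _; rewrite ?mcoeffX ?(negPf lm) ?mcoeff0 mulr0 ?if_same.
case: ifP => _; last by rewrite big1.
rewrite [f in RHS]mpolyE raddf_sum; apply: eq_bigr => l _ /=.
by rewrite mcoeffZ mcoeffX.
Qed.

Lemma restr_comp F G f : restr F (restr G f) = restr (F :&: G) f.
Proof. by apply/mpolyP => m; rewrite !mcoeff_restr subsetI; do 2!case: (_ \subset _). Qed.

Lemma msuppset_eq0 m : (msuppset m \subset set0) = (m == 0%MM).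
Proof.
rewrite subset0; apply/eqP/eqP => [m0|->].
  apply/mnmP => j; rewrite mnm0E; have := in_set0 j; rewrite -m0 inE.
  by move=> /negbFE/eqP.
by apply/setP => j; rewrite !inE mnm0E.
Qed.

Lemma restr0 f : restr set0 f = (f@_0)%:MP.
Proof.
apply/mpolyP => m; rewrite mcoeff_restr msuppset_eq0 mcoeffC.
by case: eqP => [->|_]; rewrite ?mulr1 ?mulr0.
Qed.

End Restriction.

(** * Membership in the Stanley-Reisner ideal and growth of the quotient *)

Section StanleyReisnerIdeal.
Variables (k : fieldType) (n : nat) (Delta : simplicial_complex 'I_n).
Implicit Types (F G : {set 'I_n}) (f : {mpoly k[n]}).
Local Notation sr := (@sr_ideal k n Delta).

Lemma prod_sr F : F \notin Delta -> \prod_(j in F) 'X_j \in sr.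
Proof.
move=> FN; apply/asboolP; exists (fun G => (G == F)%:R).
rewrite (bigD1 F) //= eqxx mul1r [X in _ + X]big1 ?addr0 // => G /andP[_ /negPf ->].
by rewrite mul0r.
Qed.

(** The ideal is the intersection of its face primes. A nonface has a vertex outside any given face;
    conversely, if all restrictions vanish, each monomial of f has a nonface as support and is
    divisible by the product over that support. *)
Lemma sr_restrP f : reflect (forall F, F \in Delta -> restr F f = 0) (f \in sr).
Proof.
apply: (iffP idP) => [/asboolP[c ->] F FD|H].
  rewrite rmorph_sum big1 // => G GN; rewrite rmorphM rmorph_prod /=.
  have /subsetPn[j jG jF] : ~~ (G \subset F).
    by apply: contra GN; apply: face_sub FD.
  by rewrite (bigD1 j) //= restrXU (negPf jF) mul0r mulr0.
rewrite [f]mpolyE big_seq rpred_sum // => m mf.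
have mN : msuppset m \notin Delta.
  apply/negP => /H/(congr1 (fun g => g@_m)); rewrite mcoeff_restr subxx mcoeff0.
  by apply/eqP; rewrite -mcoeff_msupp.
rewrite -mul_mpolyC idealMr //.
have -> : 'X_[m] = 'X_[m - \sum_(j in msuppset m) U_(j)] * \prod_(j in msuppset m) 'X_j
    :> {mpoly k[n]}.
  rewrite mprodXE -mpolyXD submK //; apply/mnm_lepP => j; rewrite mnm_sumE.
  rewrite (eq_bigr (fun i => (i == j : nat))) => [|i _]; last by rewrite mnm1E.
  have [jm|jm] := boolP (j \in msuppset m).
    rewrite (bigD1 j) //= eqxx big1 => [|i /andP[_ /negPf ->] //].
    by rewrite addn0 lt0n; move: jm; rewrite inE.
  by rewrite big1 // => i im; case: eqP im jm => // -> ->.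
by rewrite idealMr // prod_sr.
Qed.

Lemma sr_restr f F : f \in sr -> F \in Delta -> restr F f = 0.
Proof. by move=> /sr_restrP; apply. Qed.

Lemma mem_sr_coef f :
  (forall m, msuppset m \in Delta -> f@_m = 0) -> f \in sr.
Proof.
move=> H; apply/sr_restrP => F FD; apply/mpolyP => m.
rewrite mcoeff_restr mcoeff0; case: ifPn => // mF; apply: H.
exact: face_sub FD mF.
Qed.

Local Notation SR := (stanley_reisner_ring k Delta).

Lemma sr_pi_eq f g : \pi_SR f = \pi_SR g <-> f - g \in sr.
Proof. by rewrite Quotient.idealrBE; split=> /eqP. Qed.

Lemma sr_pi_eq0 f : \pi_SR f = 0 <-> f \in sr.
Proof. by rewrite -[f in f \in _]subr0 -sr_pi_eq rmorph0. Qed.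

Definition sr_const : {rmorphism k -> SR} := \pi_SR \o @mpolyC n k.

(* A linear combination of classes vanishes once its coefficients at the
   monomials of degree at most M supported on faces do. *)
Lemma sr_growth d : (forall F, F \in Delta -> (#|F| <= d)%N) -> growth_le sr_const d.
Proof.
move=> Dd; exists (fun M x => exists f, (msize f <= M.+1)%N /\ x = \pi_SR f), #|{set 'I_n}|.
split.
- by exists 1; rewrite msize1 rmorph1.
- move=> x; exists (msize (repr x)); exists (repr x); rewrite reprK; split=> //; exact: leqnSn.
- by move=> M M' x MM [f [fM ->]]; exists f; split=> //; apply: leq_trans fM _.
- move=> M M' _ _ [f [fM ->]] [g [gM ->]]; exists (f * g); rewrite rmorphM; split=> //.
  have [->|f0] := eqVneq f 0; first by rewrite mul0r msize0.
  have [->|g0] := eqVneq g 0; first by rewrite mulr0 msize0.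
  by rewrite msizeM // -subn1 leq_subLR add1n -addSn -addnS leq_add.
move=> M J v vM vind; have [f fM] := choice vM.
pose K : finType := ({set 'I_n} * {ffun 'I_d -> 'I_M.+1})%type.
pose mon (x : K) := [multinom
   if j \in x.1 then
     if insub (index j (enum x.1)) is Some l then x.2 l : nat else 0%N
   else 0%N | j < n].
pose B := \matrix_(i < #|J|, j < #|K|) (f (enum_val i))@_(mon (enum_val j)).
have -> : (#|{set 'I_n}| * M.+1 ^ d = #|K|)%N by rewrite card_prod card_ffun !card_ord.
rewrite leqNgt; apply/negP => KJ.
(* With more vectors than codes, some nonzero combination has zero coefficient at every coded
   monomial. *)
have /rowV0Pn[c cB c0] : kermx B != 0.
  by rewrite kermx_eq0 -row_leq_rank -ltnNge (leq_ltn_trans (rank_leq_col _)).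
have cBE j : \sum_(i < #|J|) c 0 i * B i j = 0.
  by have /sub_kermxP/matrixP/(_ 0 j) := cB; rewrite !mxE.
move/eqP: c0; apply; apply/rowP => i; rewrite mxE -[i]enum_valK.
apply: (vind (fun i => c 0 (enum_rank i))).
rewrite (eq_bigr (fun i => \pi_SR (c 0 (enum_rank i) *: f i))) => [|l _]; last first.
  by rewrite -mul_mpolyC rmorphM; case: (fM l) => _ ->.
rewrite -rmorph_sum sr_pi_eq0; apply: mem_sr_coef => m mD.
rewrite raddf_sum /=.
have [degm|degm] := leqP (mdeg m) M; last first.
  rewrite big1 // => l _; rewrite mcoeffZ [X in _ * X]memN_msupp_eq0 ?mulr0 //.
  by apply: msize_mdeg_ge; apply: leq_trans degm; case: (fM l).
have mM j : (m j < M.+1)%N.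
  by rewrite ltnS (leq_trans _ degm) // mdegE (bigD1 j) //= leq_addr.
pose F := msuppset m.
pose x : K := (F, [ffun l : 'I_d => inord (nth 0%N [seq m j | j <- enum F] l)]).
have monx : mon x = m.
  apply/mnmP => j; rewrite mnmE /=; case: ifPn => [jF|]; last first.
    by rewrite inE negbK => /eqP.
  have ij : (index j (enum F) < d)%N.
    by apply: leq_trans (Dd F mD); rewrite cardE index_mem mem_enum.
  rewrite insubT ffunE /= (nth_map j) ?index_mem ?mem_enum // nth_index ?mem_enum //.
  by rewrite inordK.
have := cBE (enum_rank x); rewrite (reindex_onto enum_rank enum_val) /=; last first.
  by move=> ? _; rewrite enum_valK.
move=> e; apply: etrans e; apply: eq_big => [l|l _]; first by rewrite enum_rankK eqxx.
by rewrite mcoeffZ !mxE !enum_rankK monx.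
Qed.

End StanleyReisnerIdeal.
(** * Disconnected complexes *)

Section Disconnected.
Variables (k : fieldType) (n : nat) (Delta : simplicial_complex 'I_n).
Implicit Types (F G : {set 'I_n}) (f g : {mpoly k[n]}).
Local Notation sr := (@sr_ideal k n Delta).
Local Notation SR := (stanley_reisner_ring k Delta).

(** Restriction to a face is well defined on classes and takes values in a domain; P is its
    kernel. *)
Lemma face_prime F : F \in Delta ->
  exists P : prime_idealr SR, forall f, (\pi_SR f \in P) = (restr F f == 0).
Proof.
move=> FD.
have piE f : restr F (repr (\pi_SR f)) = restr F f.
  apply/eqP; rewrite -subr_eq0 -rmorphB; apply/eqP; apply: sr_restr FD.
  by apply/sr_pi_eq; rewrite reprK.
have [||x y|P PE] := @prime_idealr_of SR (fun x => restr F (repr x) = 0).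
- split=> [|a x y]; first by rewrite -(rmorph0 \pi_SR) piE rmorph0.
  rewrite -[a]reprK -[x]reprK -[y]reprK -rmorphM -rmorphD !piE => x0 y0.
  by rewrite rmorphD rmorphM /= x0 y0 mulr0 addr0.
- by rewrite -(rmorph1 \pi_SR) piE rmorph1; apply/eqP/oner_neq0.
- rewrite -[x]reprK -[y]reprK -rmorphM !piE rmorphM => /eqP.
  by rewrite mulf_eq0 => /orP[]/eqP ->; [left|right].
by exists P => f; rewrite PE piE; apply/asboolP/eqP.
Qed.

Lemma restr_neq0 F f : f@_0 != 0 -> restr F f != 0.
Proof.
apply: contraNneq => e; have := mcoeff_restr F f 0%MM.
by rewrite e mcoeff0 (subset_trans _ (sub0set F)) ?msuppset_eq0 // => <-.
Qed.

Lemma mcoeff0M f g : (f * g)@_0 = f@_0 * g@_0.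
Proof. exact: (rmorphM (mcoeff 0%MM)). Qed.

Variables (V : {set 'I_n}) (a b c : 'I_n).
Hypothesis faceV : forall F, F \in Delta -> F \subset V \/ F \subset ~: V.
Hypotheses (aV : a \in V) (bV : b \notin V).
Hypotheses (acD : [set a; c] \in Delta) (ac : a != c) (bD : [set b] \in Delta).

Let aD : [set a] \in Delta.
Proof. by apply: face_sub acD _; rewrite sub1set !inE eqxx. Qed.

Variable P : prime_idealr SR.
Hypothesis PE : forall f, (\pi_SR f \in P) = (f@_0 == 0).
Local Notation L := (localization P).

(** An element outside P has a nonzero constant term, so its restriction to the vertex j is nonzero
    and it cannot kill x_j. *)
Let X_loc_neq0 j : [set j] \in Delta -> loc P (\pi_SR 'X_j) <> 0.
Proof.
move=> jD /loc_eq0[u]; rewrite -[u]reprK; move: (repr u) => {}u.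
rewrite PE -rmorphM => u0 /sr_pi_eq0/sr_restr/(_ jD)/eqP.
rewrite rmorphM mulf_eq0 (negPf (restr_neq0 _ u0)) /= restrXU inE eqxx.
by rewrite -msize_poly_eq0 msizeX.
Qed.

(** If f vanishes on all faces through j, then f x_j = 0 in the ring, while x_j stays nonzero in
    L. *)
Let nonzerodivisor_restr f j s (x : L) :
  (forall y, x * y = 0 -> y = 0) -> s \notin P -> loc P s * x = loc P (\pi_SR f) ->
  [set j] \in Delta ->
  (forall F, F \in Delta -> j \in F -> restr F f = 0) -> False.
Proof.
move=> xreg sP e jD jf; apply: (X_loc_neq0 jD); apply: xreg.
apply: (loc_mulI sP); rewrite mulr0 mulrA e -!rmorphM /=.
suff -> : \pi_SR (f * 'X_j) = 0 by rewrite rmorph0.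
apply/sr_pi_eq0/sr_restrP => F FD; rewrite rmorphM /= restrXU.
by case: ifPn => [/(jf F FD) ->|_]; rewrite ?mul0r ?mulr0.
Qed.

(* If x = x1 + x2 and y = y1 + y2 split along the two parts of the complex,
   then y x1 = x y1; when x, y is regular, x thus divides x1, which forces
   x1 = 0 or x2 = 0 and makes x a zerodivisor. *)
Lemma depth_disconnected r : has_local_regular_sequence L r -> (r < 2)%N.
Proof.
move=> [[|x [|y l]] [<- //= nonu [reg _]]]; exfalso.
have xreg z : x * z = 0 -> z = 0.
  move=> xz; apply: in_ideal_nil; apply: (reg 0%N) => //=.
  by rewrite xz; case: (in_ideal_prop ([::] : seq L)).
have yreg z w : y * z = w * x -> exists w', z = w' * x.
  move=> yz; apply/in_ideal1; apply: (reg 1%N) => //=.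
  by apply/in_ideal1; exists w.
have [|al [s [alP sP ex]]] := loc_nonunitP (nonu x _); first by rewrite inE eqxx.
have [|be [t [beP tP ey]]] := loc_nonunitP (nonu y _); first by rewrite !inE eqxx orbT.
move: al be alP beP ex ey => al0 be0; rewrite -[al0]reprK -[be0]reprK.
move: (repr al0) (repr be0) => al be; rewrite !PE => /eqP al00 /eqP be00 ex ey.
have restrV F f : F \subset V -> restr F (restr V f) = restr F f.
  by move=> /setIidPl FV; rewrite restr_comp FV.
have restrVC F f : f@_0 = 0 -> F \subset ~: V -> restr F (restr V f) = 0.
  move=> f0; rewrite -disjoints_subset => /disjoint_setI0 FV.
  by rewrite restr_comp FV restr0 f0 mpolyC0.
(* On faces inside V both sides restrict like [be * al]; on the others both vanish, as [al] and [be]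
   have no constant term. *)
have e1 : \pi_SR (be * restr V al) = \pi_SR (restr V be * al).
  apply/sr_pi_eq/sr_restrP => F FD; rewrite rmorphB !rmorphM /=.
  have [FV|FV] := faceV FD; first by rewrite !restrV // subrr.
  by rewrite !restrVC // mulr0 mul0r subrr.
have [|w] := yreg (loc P t * loc P (\pi_SR (restr V al))) (loc P (\pi_SR (restr V be)) * loc P s).
  by rewrite mulrA [y * _]mulrC ey -mulrA ex -!rmorphM /= e1.
have [ga [om [omP ew]]] := locP w => e2.
have /loc_eq0[u uP] : loc P (t * om * s * \pi_SR (restr V al) - ga * \pi_SR al) = 0.
  by rewrite rmorphB !rmorphM /= -ew -ex; ring: e2.
clear ey ew e2; move: tP omP sP uP ex; rewrite -[t]reprK -[om]reprK -[s]reprK -[u]reprK -[ga]reprK.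
move: (repr t) (repr om) (repr s) (repr u) (repr ga) => {}t {}om {}s {}u {}ga.
rewrite !PE => t0 om0 s0 u0 ex.
rewrite -!rmorphM -rmorphB -rmorphM => /sr_pi_eq0 e3.
have {}e3 F : F \in Delta ->
    restr F (u * (t * om * s)) * restr F (restr V al) = restr F (u * ga) * restr F al.
  move=> FD; apply/eqP; rewrite -subr_eq0 -!rmorphM -rmorphB; apply/eqP.
  by rewrite -(sr_restr e3 FD); congr (restr F _); ring.
(* In [e3], the factor [u * (t * om * s)] has a nonzero constant term. If [u * ga] has none, the
   difference of the two factors is nonzero on each face through a, where [restr V al] restricts
   like [al]; so [al] vanishes there. *)
have [g0|g0] := eqVneq (u * ga)@_0 0.
  apply: (nonzerodivisor_restr xreg _ ex aD); first by rewrite PE.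
  move=> F FD aF; have FV : F \subset V.
    by have [//|/subsetP/(_ a aF)] := faceV FD; rewrite inE aV.
  have := e3 F FD; rewrite restrV // => /eqP; rewrite -subr_eq0 -mulrBl -rmorphB.
  rewrite mulf_eq0 (negPf (restr_neq0 _ _)) /= => [/eqP //|].
  by rewrite mcoeffB g0 subr0 !mcoeff0M !mulf_neq0.
(* On faces through b, [restr V al] becomes 0 and [u * ga] does not, so [al] vanishes there. *)
apply: (nonzerodivisor_restr xreg _ ex bD); first by rewrite PE.
move=> F FD bF; have FV : F \subset ~: V.
  by have [/subsetP/(_ b bF)|//] := faceV FD; rewrite (negPf bV).
have := e3 F FD; rewrite restrVC // mulr0 => /esym/eqP.
by rewrite mulf_eq0 (negPf (restr_neq0 _ g0)) => /eqP.
Qed.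

(** The primes of the edge ac, of the vertex a and of the empty face; x_c and x_a witness
    strictness. *)
Lemma chain_edge : has_prime_chain L 2.
Proof.
have [Q2 Q2E] := face_prime acD; have [Q1 Q1E] := face_prime aD.
pose C i := if i is i'.+1 then if i' is 0%N then Q1 else P else Q2.
have P1 : {subset Q1 <= P}.
  move=> x; rewrite -[x]reprK Q1E PE => /eqP/(congr1 (restr set0)).
  rewrite restr_comp set0I restr0 rmorph0 => /eqP; by rewrite mpolyC_eq0.
have Q21 : {subset Q2 <= Q1}.
  move=> x; rewrite -[x]reprK Q2E Q1E => /eqP/(congr1 (restr [set a])).
  by rewrite restr_comp (setIidPl _) ?sub1set ?inE ?eqxx // rmorph0 => ->.
have X0 j : ('X_j : {mpoly k[n]}) != 0 by rewrite -msize_poly_eq0 msizeX.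
apply: (chain_loc (C := C)) => [[|[|//]] _|[|[|[|//]]] _] //=.
- split=> //; exists (\pi_SR 'X_c).
    by rewrite Q1E restrXU inE [c == a]eq_sym (negPf ac).
  by rewrite Q2E restrXU !inE eqxx orbT.
- split=> //; exists (\pi_SR 'X_a); rewrite ?Q1E ?PE.
    by rewrite mcoeffX -mdeg_eq0 mdeg1.
  by rewrite restrXU inE eqxx.
- by move=> x /Q21/P1.
Qed.

End Disconnected.

Lemma S2_connected (k : fieldType) n (Delta : simplicial_complex 'I_n) (V : {set 'I_n}) a b c :
  (forall F, F \in Delta -> F \subset V \/ F \subset ~: V) ->
  a \in V -> b \notin V -> [set a; c] \in Delta -> a != c -> [set b] \in Delta ->
  ~ S2_complex k Delta.
Proof.
move=> faceV aV bV acD ac bD S2.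
have [P PE] := face_prime k (face0 Delta).
have {}PE f : (\pi_(stanley_reisner_ring k Delta) f \in P) = (f@_0 == 0).
  by rewrite PE restr0 mpolyC_eq0.
have [d [e [[_ dmax] [ereg _] de]]] := S2 P.
have := dmax _ (chain_edge acD ac PE).
have := depth_disconnected faceV aV bV acD bD PE ereg.
move: de; rewrite geq_min; lia.
Qed.

(** * Graphs covered by a walk *)

Section WalkComplex.
Variables (k : fieldType) (n : nat) (Delta : simplicial_complex 'I_n).
(** The walk is infinite: it may wind around a cycle or go back and forth on one edge. Its first
    [len] edges contain every face, which keeps maxima over edges finite. *)
Variables (v : nat -> 'I_n) (len : nat).
Local Notation edge_at t := [set v t; v t.+1].
Hypothesis v_neq : forall t, v t != v t.+1.
Hypothesis vD : forall t, edge_at t \in Delta.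
Hypothesis D_edge : forall F, F \in Delta -> exists2 t, (t < len)%N & F \subset edge_at t.
Implicit Types (F G : {set 'I_n}) (f g h : {mpoly k[n]}).
Local Notation sr := (@sr_ideal k n Delta).
Local Notation SR := (stanley_reisner_ring k Delta).
Local Notation B := {poly {poly k}}.
Local Notation sum2 := ('X%:P : B).

(* Restriction to an edge {a, b}, in the coordinates x_a and x_a + x_b. *)
Definition rho t : {mpoly k[n]} -> B :=
  mmap (polyC \o polyC)
    (fun j => if j == v t then 'X else if j == v t.+1 then sum2 - 'X else 0).

HB.instance Definition _ t := GRing.RMorphism.copy (rho t) (mmap (polyC \o polyC)
    (fun j => if j == v t then 'X else if j == v t.+1 then sum2 - 'X else 0)).

Local Notation sigma0 t :=
  (horner_eval ('X_(v t) + 'X_(v t.+1) : {mpoly k[n]}) \o map_poly (@mpolyC n k)).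

(** The change of coordinates back: the outer variable becomes x_a, the inner one x_a + x_b. *)
Definition sigma t : B -> {mpoly k[n]} :=
  horner_eval ('X_(v t) : {mpoly k[n]}) \o map_poly (sigma0 t).

HB.instance Definition _ t := GRing.RMorphism.copy (sigma t)
  (horner_eval ('X_(v t) : {mpoly k[n]}) \o map_poly (sigma0 t)).

Lemma rhoC t c : rho t c%:MP = c%:P%:P. Proof. exact: mmapC. Qed.

Lemma rhoX t j :
  rho t 'X_j = if j == v t then 'X else if j == v t.+1 then sum2 - 'X else 0.
Proof. by rewrite /rho mmapX mmap1U. Qed.

Lemma sigmaC t (p : {poly k}) :
  sigma t p%:P = (map_poly (@mpolyC n k) p).['X_(v t) + 'X_(v t.+1)].
Proof.
transitivity ((map_poly (sigma0 t) p%:P).['X_(v t)]) => //.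
by rewrite map_polyC hornerC.
Qed.

Lemma sigmaX t : sigma t 'X = 'X_(v t).
Proof.
transitivity ((map_poly (sigma0 t) 'X).['X_(v t)]) => //.
by rewrite map_polyX hornerX.
Qed.

Lemma sigma_sum2 t : sigma t sum2 = 'X_(v t) + 'X_(v t.+1).
Proof. by rewrite sigmaC map_polyX hornerX. Qed.

Lemma sigma_rho t f : sigma t (rho t f) = restr (edge_at t) f.
Proof.
move: f; apply: (mpoly_rmorph_ext (f := sigma t \o rho t) (g := restr (edge_at t))) => [c|j] /=.
  by rewrite rhoC sigmaC map_polyC hornerC restrC.
rewrite rhoX restrXU !inE; case: eqP => [->|_] /=; first exact: sigmaX.
case: eqP => [->|_]; last exact: rmorph0.
by rewrite rmorphB /= sigma_sum2 sigmaX addrC addKr.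
Qed.

Lemma rho_restr t f : rho t (restr (edge_at t) f) = rho t f.
Proof.
move: f; apply: (mpoly_rmorph_ext (f := rho t \o restr (edge_at t)) (g := rho t)) => [c|j] /=.
  by rewrite restrC.
rewrite restrXU !inE; case: ifPn => //; rewrite negb_or => /andP[/negPf j1 /negPf j2].
by rewrite rmorph0 rhoX j1 j2.
Qed.

(** Each face lies on an edge of the walk, and [sigma] recovers the restriction to that edge from
    [rho]. The ring thus embeds in a product of domains. *)
Lemma sr_rhoP f : (f \in sr) <-> forall t, rho t f = 0.
Proof.
split=> [fsr t|H]; first by rewrite -rho_restr (sr_restr fsr (vD t)) rmorph0.
apply/sr_restrP => F /D_edge[t _ /setIidPl FE].
by rewrite -FE -restr_comp -sigma_rho H !rmorph0.
Qed.

Definition theta1 : {mpoly k[n]} := \sum_j 'X_j.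
Definition theta2 : {mpoly k[n]} := \sum_(F in Delta | #|F| == 2) \prod_(j in F) 'X_j.
(** The product x_a x_b in the coordinates of [rho]. *)
Definition quad : B := 'X * (sum2 - 'X).

Lemma rho_theta1 t : rho t theta1 = sum2.
Proof.
rewrite rmorph_sum (bigD1 (v t)) //= (bigD1 (v t.+1)) /=; last by rewrite eq_sym.
rewrite !rhoX !eqxx [v t.+1 == _]eq_sym (negPf (v_neq t)) big1 ?addr0.
  by rewrite addrC subrK.
move=> j /andP[/negPf j1 /negPf j2].
by rewrite rhoX j1 j2.
Qed.

Lemma rho_theta2 t : rho t theta2 = quad.
Proof.
rewrite rmorph_sum (bigD1 (edge_at t)) /=; last by rewrite vD cards2 v_neq.
rewrite big_setU1 ?inE ?v_neq // big_set1 rmorphM /= !rhoX !eqxx.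
rewrite [v t.+1 == _]eq_sym (negPf (v_neq t)) [X in _ + X]big1 ?addr0 // => F.
move=> /andP[/andP[FD /eqP F2] FE].
have /subsetPn[j jF] : ~~ (F \subset edge_at t).
  by apply: contra FE => FE; rewrite eqEcard FE F2 cards2 v_neq.
rewrite !inE negb_or => /andP[/negPf j1 /negPf j2].
by rewrite (bigD1 j) //= rmorphM /= rhoX j1 j2 mul0r.
Qed.

Lemma size_quad : size quad = 3 /\ lead_coef quad = -1.
Proof.
have q : quad = - 'X ^+ 2 + ('X : {poly k}) *: 'X by rewrite /quad -mul_polyC; ring.
have s : (size (('X : {poly k}) *: 'X : B) < size (- 'X ^+ 2 : B))%N.
  rewrite size_polyN size_polyXn; apply: leq_ltn_trans (size_scale_leq _ _) _.
  by rewrite size_polyX.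
by rewrite q size_polyDl // lead_coefDl // size_polyN size_polyXn lead_coefN lead_coefXn.
Qed.

(** The two variables of B are independent, and substituting the nonconstant [quad] for the outer
    one is injective. *)
Lemma algind_quad : algind (polyC \o polyC) (fun x : B => x = 0) [:: quad; sum2].
Proof.
have i0 : algind (idfun : {rmorphism k -> k}) (fun x => x = 0) [::].
  apply: algind_nil => [|/eqP]; last by rewrite (negPf (oner_neq0 _)).
  by split=> // a x y -> ->; rewrite mulr0 addr0.
have coef0 (A : nzRingType) (F : {poly A}) i : F = 0 -> F`_i = 0 by move=> ->; rewrite coef0.
have i2 := algind_polyX (@coef0 _) (algind_polyX (@coef0 _) i0).
have i3 : algind (polyC \o (polyC \o idfun)) (fun x : B => comp_poly quad x = 0) [:: 'X; sum2].
  apply: algind_sub i2 => x /eqP; rewrite comp_poly_eq0 => [/eqP //|].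
  by rewrite size_quad.1.
have := algind_map (f := comp_poly quad) (I := fun x : B => x = 0) i3.
rewrite /= comp_polyX comp_polyC; apply: algind_eq => c.
exact: comp_polyC.
Qed.

Definition peval (th : {mpoly k[n]}) (p : {poly k}) : {mpoly k[n]} :=
  \sum_(i < size p) (p`_i)%:MP * th ^+ i.

Lemma rho_peval1 t p : rho t (peval theta1 p) = p%:P.
Proof.
rewrite rmorph_sum -[in RHS](coefK p) poly_def rmorph_sum; apply: eq_bigr => i _ /=.
by rewrite rmorphM rmorphXn /= rhoC rho_theta1 -mul_polyC !rmorphM rmorphXn.
Qed.

Lemma rho_peval2 t p : rho t (peval theta2 p) = map_poly polyC p \Po quad.
Proof.
rewrite rmorph_sum comp_polyE size_map_polyC; apply: eq_bigr => i _ /=.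
by rewrite rmorphM rmorphXn /= rhoC rho_theta2 coef_map mul_polyC.
Qed.

(** In the outer variable [quad] has leading coefficient -1, so that of p([quad]) is the one of p up
    to sign. *)
Lemma lead_peval2 t p : p != 0 -> lead_coef (rho t (peval theta2 p)) \is a GRing.unit.
Proof.
move=> p0; rewrite rho_peval2 lead_coef_comp ?size_quad.1 // size_quad.2.
rewrite lead_coef_map_inj //; last exact: polyC_inj.
by rewrite unitrM unitrX ?unitrN1 // andbT rmorph_unit // unitfE lead_coef_eq0.
Qed.

Lemma sr_mulI h f : (forall t, rho t h != 0) -> h * f \in sr -> f \in sr.
Proof.
move=> h0 /sr_rhoP hf; apply/sr_rhoP => t; have /eqP := hf t.
by rewrite rmorphM mulf_eq0 (negPf (h0 t)) => /eqP.
Qed.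

(** * Division on each edge and gluing of the quotients *)

Section Gluing.
Variables (h : {mpoly k[n]}) (f1 : {poly k}).
Hypotheses (f1_neq0 : f1 != 0) (rho_h : forall t, rho t h = f1%:P).

(** On an edge h is f1(x_a + x_b), which restricts to f1(x_j) at either end j. *)
Lemma restr_vertex_neq0 t j : j \in edge_at t -> restr [set j] h != 0.
Proof.
move=> jt; have -> : restr [set j] h = (map_poly (@mpolyC n k) f1).['X_j].
  have {1}-> : [set j] = [set j] :&: edge_at t by apply/esym/setIidPl; rewrite sub1set.
  rewrite -restr_comp -sigma_rho rho_h sigmaC horner_coef rmorph_sum horner_coef.
  apply: eq_bigr => i _ /=; rewrite rmorphM rmorphXn rmorphD /= !restrXU !inE coef_map restrC.
  move: jt; rewrite !inE; have [-> _|_ /= /eqP ->] := eqVneq j (v t); last first.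
    by rewrite eqxx add0r.
  by rewrite [v t.+1 == _]eq_sym (negPf (v_neq t)) addr0.
pose X := fun _ : 'I_n => 'X : {poly k}.
apply: contra_neq f1_neq0 => e; have := congr1 (mmap polyC X) e.
rewrite rmorph0 horner_coef rmorph_sum size_map_inj_poly //=; last exact: (can_inj (@mpolyCK _ _)).
move=> <-; rewrite -[LHS]coefK poly_def; apply: eq_bigr => i _.
by rewrite rmorphM rmorphXn /= coef_map /= mmapC mmapX mmap1U mul_polyC.
Qed.

Lemma restr_face_neq0 F t j : j \in F -> F \subset edge_at t -> restr F h != 0.
Proof.
move=> jF Ft; have jt : j \in edge_at t by apply: (subsetP Ft).
apply: contraNneq (restr_vertex_neq0 jt) => e.
have /setIidPl {1}<- : [set j] \subset F by rewrite sub1set.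
by rewrite -restr_comp e rmorph0.
Qed.

Lemma restr_subK F G f : F \subset G -> restr F (restr G f) = restr F f.
Proof. by move=> /setIidPl FG; rewrite restr_comp FG. Qed.

Lemma glue_restr w f : (forall t, w t = restr (edge_at t) (w t)) ->
  (forall t, restr (edge_at t) h * w t = restr (edge_at t) f) ->
  exists g, forall t, restr (edge_at t) g = w t.
Proof.
move=> wE hw.
(* On a common nonempty face both are quotients of f by h, and h is nonzero there. *)
have agree F t t' j : j \in F -> F \subset edge_at t -> F \subset edge_at t' ->
    restr F (w t) = restr F (w t').
  move=> jF Ft Ft'; apply: (mulfI (restr_face_neq0 jF Ft)).
  rewrite -[in LHS](restr_subK h Ft) -[in RHS](restr_subK h Ft') -!rmorphM /= !hw.
  by rewrite !restr_subK.
(* At the empty face h is f1(0), which may vanish. Constant terms are compared through the vertex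
   shared by consecutive edges. *)
have agree0 t : (w t)@_0 = (w 0%N)@_0.
  elim: t => // t <-; apply: (can_inj (@mpolyCK n k)); rewrite -!restr0.
  have vt : [set v t.+1] \subset edge_at t by rewrite sub1set !inE eqxx orbT.
  have vt' : [set v t.+1] \subset edge_at t.+1 by rewrite sub1set !inE eqxx.
  rewrite -(restr_subK (w t) (sub0set [set v t.+1])) (agree _ _ t.+1 (v t.+1)) ?inE //.
  by rewrite restr_subK ?sub0set.
have agreem m t t' : msuppset m \subset edge_at t -> msuppset m \subset edge_at t' ->
    (w t)@_m = (w t')@_m.
  move=> mt mt'; have [m0|[j jm]] := set_0Vmem (msuppset m).
    have -> : m = 0%MM by apply/eqP; rewrite -msuppset_eq0 m0.
    by rewrite !agree0.
  have := congr1 (mcoeff m) (agree _ _ _ _ jm mt mt').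
  by rewrite !mcoeff_restr subxx.
(* A degree bound for all the [w t], since every edge is contained in one of the first [len]. *)
pose b := \max_(t < len) msize (w t).
pose E m := if [pick t : 'I_len | msuppset m \subset edge_at t] is Some t
  then (w t)@_m else 0.
have EE m t : msuppset m \subset edge_at t -> E m = (w t)@_m.
  move=> mt; rewrite /E; case: pickP => [t' mt'|no]; first exact: agreem.
  have [t' lt' tt'] := D_edge (vD t).
  by have := no (Ordinal lt'); rewrite (subset_trans mt tt').
exists (\sum_(m : 'X_{1..n < b}) E m *: 'X_[m]) => t; apply/mpolyP => m.
rewrite mcoeff_restr; case: ifPn => mt; last by rewrite wE mcoeff_restr (negPf mt).
have [mb|mb] := ltnP (mdeg m) b; first by rewrite mcoeff_mpoly // (EE _ _ mt).
have [t' lt' tt'] := D_edge (vD t).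
rewrite (agreem m t t' mt (subset_trans mt tt')) [RHS]memN_msupp_eq0.
  rewrite raddf_sum big1 // => -[l lb] _ /=; rewrite mcoeffZ mcoeffX.
  case: eqP => [lm|]; last by rewrite mulr0.
  by move: lb; rewrite /= lm ltnNge mb.
apply: msize_mdeg_ge; apply: leq_trans mb.
exact: (leq_bigmax (F := fun t : 'I_len => msize (w t)) (Ordinal lt')).
Qed.

(* Division by h on each edge glues to a division by h on the complex: the
   quotients agree at the vertices, where h does not vanish, and their constant
   terms agree because the edges form a walk. *)
Lemma glue_division f : (forall t i, f1 %| (rho t f)`_i) -> exists g, f - h * g \in sr.
Proof.
move=> f1f.
(* On the edge h is the constant f1 of k[X][X], so the division is made coefficientwise. *)
pose q t := \poly_(i < size (rho t f)) ((rho t f)`_i %/ f1).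
have hq t : f1%:P * q t = rho t f.
  apply/polyP => i; rewrite coefCM coef_poly; case: ltnP => [_|si].
    by rewrite mulrC divpK.
  by rewrite mulr0 nth_default.
pose w t := restr (edge_at t) (sigma t (q t)).
have hw t : restr (edge_at t) h * w t = restr (edge_at t) f.
  transitivity (restr (edge_at t) (restr (edge_at t) h * sigma t (q t))).
    by rewrite rmorphM /= restr_subK.
  by rewrite -(sigma_rho t h) rho_h -rmorphM /= hq sigma_rho restr_subK.
have [t|g gE] := glue_restr _ hw; first by rewrite /w restr_subK.
exists g; apply/sr_restrP => F /D_edge[t _ Ft].
rewrite rmorphB rmorphM /= -(restr_subK f Ft) -(restr_subK h Ft) -(restr_subK g Ft) gE.
by rewrite -hw rmorphM subrr.
Qed.

End Gluing.

(** If h2 y is a multiple of h1, then on each edge f1 divides the coefficients of the product; the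
    unit leading coefficient of h2 passes this on to y, and [glue_division] makes y a multiple of
    h1. *)
Lemma regular_at_pair (P : prime_idealr SR) (h1 h2 : {mpoly k[n]}) (f1 : {poly k}) :
  f1 != 0 -> (forall t, rho t h1 = f1%:P) ->
  (forall t, lead_coef (rho t h2) \is a GRing.unit) ->
  \pi_SR h1 \in P -> \pi_SR h2 \in P -> regular_at P [:: \pi_SR h1; \pi_SR h2].
Proof.
move=> f10 rho1 rho2 h1P h2P; split=> [x|].
  by rewrite !inE => /orP[]/eqP ->.
move=> [|[|//]] _ y /= H; exists 1; rewrite ?idealr1 // mul1r.
  move: H; rewrite -[y]reprK -rmorphM => /in_ideal_nil/sr_pi_eq0 hy.
  rewrite (_ : \pi_SR _ = 0); first by case: (in_ideal_prop ([::] : seq SR)).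
  apply/sr_pi_eq0; apply: sr_mulI hy => t; by rewrite rho1 polyC_eq0.
move: H => /in_ideal1[z]; rewrite -[y]reprK -[z]reprK -!rmorphM.
move: (repr y) (repr z) => {}y {}z /sr_pi_eq/sr_rhoP yz.
have [t i|w hw] := glue_division (f := y) f10 rho1.
  have Iid : ideal_prop (fun a => f1 %| a).
    by split=> [|a b c fb fc]; rewrite ?dvdp0 // dvdp_add // dvdp_mull.
  have [j|N HN] := coef_mul_ideal Iid (F := rho t h2) (y := rho t y).
    have /eqP := yz t; rewrite rmorphB !rmorphM /= subr_eq0 rho1 => /eqP ->.
    by rewrite coefMC dvdp_mulIr.
  have uN := unitrX N (rho2 t).
  by rewrite -(mulKr uN (rho t y)`_i) dvdp_mull.
apply/in_ideal1; exists (\pi_SR w); rewrite -rmorphM; apply/sr_pi_eq.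
by rewrite [w * h1]mulrC.
Qed.

Lemma dependency (P : prime_idealr SR) (t : seq {mpoly k[n]}) :
  ~ algind (sr_const k Delta) (fun x => x \in P) (map \pi_SR t) ->
  exists N (c : midx N (size t) -> k), (exists e, c e != 0) /\
    \pi_SR (\sum_e (c e)%:MP * mono t e) \in P.
Proof.
move=> /existsNP[N]; rewrite size_map => /existsNP[c /not_implyP[cP /existsNP[e /eqP ce]]].
exists N, c; split; first by exists e.
rewrite rmorph_sum /=; move: cP; congr (_ \in P).
by apply: eq_bigr => i _; rewrite mono_map rmorphM.
Qed.

Lemma peval_algind (P : prime_idealr SR) th :
  (forall p, p != 0 -> \pi_SR (peval th p) \notin P) ->
  algind (sr_const k Delta) (fun x => x \in P) [:: \pi_SR th].
Proof.
move=> H; apply: contrapT => /(dependency (t := [:: th]))[N [c [[[j []] cj]]]].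
apply/negP; case: N c j cj => [_ []//|N] c j cj.
pose p := \poly_(j < N.+1) c (inord j, tt).
have pj : p`_j = c (j, tt) by rewrite coef_poly ltn_ord inord_val.
have p0 : p != 0 by apply: contraNneq cj => p0; rewrite -pj p0 coef0.
have := H p p0; congr (\pi_SR _ \notin P).
rewrite sum_midxS /peval (big_ord_widen N.+1 (fun i => (p`_i)%:MP * th ^+ i)) ?size_poly //.
rewrite big_mkcond; apply: eq_bigr => i _.
rewrite sum_midx0 /= mulr1; case: ltnP => [_|ip].
  by rewrite coef_poly ltn_ord inord_val.
have -> : c (i, tt) = p`_i by rewrite coef_poly ltn_ord inord_val.
by rewrite nth_default // mpolyC0 mul0r.
Qed.

(** If both thetas are independent modulo P, no regular element is needed. Otherwise a relation h
    between them is a regular element of P; it suffices when one theta alone is independent, and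
    else [regular_at_pair] provides two. *)
Lemma regular_primes_walk : regular_primes (sr_const k Delta) 2.
Proof.
move=> P.
have reg1 h : (forall t, rho t h != 0) -> \pi_SR h \in P -> regular_at P [:: \pi_SR h].
  move=> h0 hP; split=> [x|]; first by rewrite inE => /eqP ->.
  move=> [|//] _ y /= H; exists 1; rewrite ?idealr1 // mul1r.
  move: H; rewrite -[y]reprK -rmorphM => /in_ideal_nil/sr_pi_eq0 hy.
  rewrite (_ : \pi_SR _ = 0); first by case: (in_ideal_prop ([::] : seq SR)).
  by apply/sr_pi_eq0; apply: sr_mulI hy.
have [t12|/(dependency (t := [:: theta2; theta1]))] :=
    EM (algind (sr_const k Delta) (fun x => x \in P) [:: \pi_SR theta2; \pi_SR theta1]).
  by exists [:: \pi_SR theta2; \pi_SR theta1], [::].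
move=> [N [c [[e ce] hP]]]; set h := \sum_e _ in hP.
(* On every edge the thetas become [quad] and [sum2], which satisfy no relation. *)
have h0 t : rho t h != 0.
  apply: contra_neq ce => rh0; apply: (algind_quad (N := N) (c := c)).
  rewrite -[RHS]rh0 /h rmorph_sum; apply: eq_bigr => i _; rewrite rmorphM /= rhoC; congr (_ * _).
  by rewrite !(rmorphM, rmorphXn, rmorph1) /= rho_theta1 rho_theta2.
have [nt1|/existsNP[p1 /not_implyP[p10 /negP/negbNE p1P]]] :=
    EM (forall p, p != 0 -> \pi_SR (peval theta1 p) \notin P).
  exists [:: \pi_SR theta1], [:: \pi_SR h]; split=> //; [exact: peval_algind|exact: reg1].
have [nt2|/existsNP[p2 /not_implyP[p20 /negP/negbNE p2P]]] :=
    EM (forall p, p != 0 -> \pi_SR (peval theta2 p) \notin P).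
  exists [:: \pi_SR theta2], [:: \pi_SR h]; split=> //; [exact: peval_algind|exact: reg1].
exists [::], [:: \pi_SR (peval theta1 p1); \pi_SR (peval theta2 p2)]; split=> //.
  by apply: algind_nil; [exact: prime_prop|rewrite idealr1].
apply: (regular_at_pair p10) => // t; [exact: rho_peval1|exact: lead_peval2].
Qed.

Lemma walk_face_card F : F \in Delta -> (#|F| <= 2)%N.
Proof. by move=> /D_edge[t _ /subset_leq_card]; rewrite cards2 v_neq. Qed.

Lemma walk_complex_CM : cohen_macaulay_ring SR.
Proof. exact: regular_primes_CM (sr_growth k walk_face_card) regular_primes_walk. Qed.

End WalkComplex.

(** There is no nonface, so the ideal is zero and the quotient map is an isomorphism from the
    polynomial ring. *)
Lemma simplex_CM (k : fieldType) n (Delta : simplicial_complex 'I_n) :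
  (forall F, F \in Delta) -> cohen_macaulay_ring (stanley_reisner_ring k Delta).
Proof.
move=> allD; have gr : growth_le (sr_const k Delta) n.
  by apply: sr_growth => F _; rewrite -[X in (_ <= X)%N]card_ord max_card.
apply: (regular_primes_CM gr); rewrite /sr_const.
apply: regular_primes_iso; last exact: regular_primes_mpoly.
exists repr; last exact: reprK.
move=> f; apply/eqP; rewrite -subr_eq0; apply/eqP.
have /sr_restrP/(_ setT (allD _)) :
    repr (\pi_(stanley_reisner_ring k Delta) f) - f \in @sr_ideal k n Delta.
  by apply/sr_pi_eq; rewrite reprK.
by move=> e; rewrite -[RHS]e; apply/mpolyP => m; rewrite mcoeff_restr subsetT.
Qed.
(** * Circulant graphs *)

Section CirculantFaces.
Local Open Scope nat_scope.
Variables (n i : nat).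
Hypothesis hi : (1 <= i <= n./2)%N.
Local Notation G := (circulant_all_but n i).

Lemma modn_lt2 x : (x < n + n)%N -> x %% n = if (x < n)%N then x else (x - n)%N.
Proof.
move=> xn; have [/modn_small //|nx] := ltnP x n.
by rewrite -{1}(subnK nx) modnDr modn_small //; lia.
Qed.

(** The cyclic distance of distinct vertices lies between 1 and n/2, and i is the only such value
    that S omits. *)
Lemma circulant_nonedge (a b : 'I_n) : a != b ->
  ~~ G a b = ((a + i) %% n == b)%N || ((b + i) %% n == a)%N.
Proof.
have an := ltn_ord a; have bn := ltn_ord b.
rewrite -(inj_eq val_inj) /= => ab; rewrite !modn_lt2; try lia.
rewrite /circulant_rel !inE.
have -> : `|a - b|%N = ((a - b) + (b - a))%N by lia.
have n2 : n./2 * 2 <= n < n./2 * 2 + 2 by lia.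
move: (n./2) (nat_of_ord a) (nat_of_ord b) (hi) n2 an bn ab => h x y hi' n2 xn yn xy.
case: (ltnP (x + i) n) => ?; case: (ltnP (y + i) n) => ?; case: (ltnP x y) => ?; apply/idP/idP; lia.
Qed.

Lemma circulant_faceP (F : {set 'I_n}) :
  reflect {in F &, forall a b : 'I_n, a != b ->
    ((a + i) %% n == b)%N || ((b + i) %% n == a)%N} (F \in independence_complex G).
Proof.
rewrite inE; apply: (iffP forall_inP) => H a.
  by move=> b aF bF ab; rewrite -circulant_nonedge // (forall_inP (H a aF)).
move=> aF; apply/forall_inP => b bF; have [<-|ab] := eqVneq a b.
  by rewrite (edge_irr G).
by rewrite circulant_nonedge // H.
Qed.

Lemma circulant_face1 a : [set a] \in independence_complex G.
Proof.
by apply/circulant_faceP => x y; rewrite !inE => /eqP -> /eqP ->; rewrite eqxx.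
Qed.

Lemma circulant_face2 (a b : 'I_n) : ((a + i) %% n)%N = b -> [set a; b] \in independence_complex G.
Proof.
move=> ab; apply/circulant_faceP => x y; rewrite !inE.
by case/orP=> /eqP -> /orP[]/eqP ->; rewrite ?eqxx // ab eqxx ?orbT.
Qed.

Lemma circulant_n_gt1 : (1 < n)%N. Proof. lia. Qed.

(** Adding i modulo n preserves divisibility by g = gcd(i, n). For g > 1 the multiples of g thus
    split off; they contain the edge {0, i} but not the vertex 1. *)
Lemma S2_circulant (k : fieldType) : S2_graph k G -> gcdn i n = 1%N.
Proof.
have n_gt1 := circulant_n_gt1; have n_gt0 := ltnW n_gt1.
have i_lt : (i < n)%N by lia.
set g := gcdn i n => S2; apply/eqP; rewrite eqn_leq gcdn_gt0 n_gt0 orbT andbT leqNgt.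
apply/negP => g_gt1.
pose V := [set j : 'I_n | g %| j].
apply: (@S2_connected k n (independence_complex G) V
  (Ordinal n_gt0) (Ordinal n_gt1) (Ordinal i_lt)) => //.
- have gE (a b : 'I_n) : ((a + i) %% n)%N = b -> (g %| b) = (g %| a).
    move=> <-; rewrite /dvdn modn_dvdm ?dvdn_gcdr // -/(dvdn _ _).
    by rewrite dvdn_addl // dvdn_gcdl.
  move=> F /circulant_faceP FD.
  have [->|[a aF]] := set_0Vmem F; first by left; exact: sub0set.
  have E (b : 'I_n) : b \in F -> (g %| b) = (g %| a).
    move=> bF; have [-> //|ab] := eqVneq a b.
    by case/orP: (FD a b aF bF ab) => /eqP/gE.
  case ga: (g %| a); [left|right]; apply/subsetP => b /E; rewrite !inE ga => -> //.
- by rewrite inE dvdn0.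
- by rewrite inE dvdn1 neq_ltn g_gt1 orbT.
- by apply: circulant_face2; rewrite /= modn_small.
- by rewrite -(inj_eq val_inj) /= neq_ltn; lia.
- exact: circulant_face1.
Qed.

Lemma circulant_CM : gcdn i n = 1%N -> cohen_macaulay_graph G.
Proof.
move=> gcd1 k.
have n_gt1 := circulant_n_gt1; have n_gt0 := ltnW n_gt1.
(* For n = 3 all three vertices are pairwise at distance i = 1, and every set is a face. *)
have [n3|n3] := eqVneq n 3%N.
  apply: simplex_CM => F; apply/circulant_faceP => a b _ _.
  have := ltn_ord a; have := ltn_ord b; rewrite -(inj_eq val_inj) /= => bn an ab.
  rewrite !modn_lt2; try lia.
  case: (ltnP (a + i) n) => ?; case: (ltnP (b + i) n) => ?; lia.
(* The walk 0, i, 2i, ... modulo n. *)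
pose v t : 'I_n := Ordinal (ltn_pmod (t * i) n_gt0).
have vS t : ((v t + i) %% n)%N = v t.+1 by rewrite /= modnDml mulSn addnC.
(* By Bezout km i = 1 modulo n, so x is reached at time x km. *)
have v_surj (x : 'I_n) : exists2 t, (t < n)%N & v t = x.
  have i_gt0 : (0 < i)%N by lia.
  have [km kn e _] := egcdnP n i_gt0.
  exists ((x * km) %% n)%N; first exact: ltn_pmod.
  apply: val_inj; rewrite /= modnMml -mulnA e gcd1 mulnDr muln1 mulnA modnMDl.
  by rewrite modn_small.
have addi_neq (x : 'I_n) : ((x + i) %% n)%N != x.
  have := ltn_ord x => xn; rewrite modn_lt2; [case: ltnP|]; lia.
have covered (F : {set 'I_n}) (x y : 'I_n) : F \in independence_complex G ->
    x \in F -> y \in F -> ((x + i) %% n)%N = y ->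
    exists2 t, (t < n)%N & F \subset [set v t; v t.+1].
  move=> /circulant_faceP FD xF yF xy; have [t tn tx] := v_surj x; exists t => //.
  have ty : v t.+1 = y by apply: val_inj; rewrite -[LHS]vS tx.
  rewrite tx ty; apply/subsetP => z zF; rewrite !inE; apply/norP => -[zx zy].
  have zx' : (z + i) %% n = x.
    have := FD x z xF zF; rewrite xy -(inj_eq val_inj) eq_sym => /(_ zx)/orP[|/eqP //].
    by move=> /eqP/val_inj yz; rewrite yz eqxx in zy.
  have yz' : (y + i) %% n = z.
    have := FD y z yF zF; rewrite zx' eq_sym => /(_ zy)/orP[/eqP //|].
    by move=> e; move: (addi_neq x); rewrite xy eq_sym e.
  (* A third vertex z closes the circuit x, y, z after three steps of i. As i is prime to n, n
     divides 3, against n > 1 and n != 3. *)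
  have : n %| 3 * i.
    have : x + 3 * i = x + 0 %[mod n].
      rewrite addn0 -[in RHS]zx' -yz' -xy !modnDml modn_mod -addnA modnDml.
      by congr (_ %% _); lia.
    by move=> /eqP; rewrite eqn_modDl mod0n.
  rewrite Gauss_dvdl; last by rewrite coprime_sym /coprime gcd1.
  move=> n_dvd3; have n_le3 := dvdn_leq (isT : 0 < 3) n_dvd3.
  have n2 : n = 2 by lia.
  by move: n_dvd3; rewrite n2.
apply: (@walk_complex_CM k n _ v n).
- by move=> t; rewrite -(inj_eq val_inj) -[X in _ != X]vS eq_sym addi_neq.
- by move=> t; apply: circulant_face2; rewrite vS.
(* A face without two vertices that differ by i has at most one vertex, and a single vertex starts
   an edge of the walk. *)
move=> F FD; have [[x [y [xF yF xy]]]|H] :=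
    EM (exists x y : 'I_n, [/\ x \in F, y \in F & (x + i) %% n = y]).
  exact: (covered F x y).
have [->|[x xF]] := set_0Vmem F; first by exists 0; rewrite ?sub0set.
have [t tn tx] := v_surj x; exists t => //; apply/subsetP => y yF.
apply/set2P; left; apply/eqP; rewrite tx eq_sym; apply: contraT => xy.
case: H; case/orP: (elimT (circulant_faceP F) FD x y xF yF xy) => /eqP e.
  by exists x, y.
by exists y, x.
Qed.

End CirculantFaces.

Theorem theorem4p1 (k : fieldType) (n i : nat) (hi : (1 <= i <= n./2)%N) :
  [<-> S2_graph k (circulant_all_but n i);
       cohen_macaulay_graph (circulant_all_but n i);
       gcdn i n = 1%N].
Proof.
tfae.
- by move=> /(S2_circulant hi); apply: circulant_CM.
- by move=> CM; apply: (S2_circulant hi (k := k)); apply: cohen_macaulay_serre.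
- by move=> /(circulant_CM hi)/(_ k); apply: cohen_macaulay_serre.
Qed.
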